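(* For every integer $n\ge 3$, the number of combinatorial types of plane branches with blow-up complexity $n$ (that is, the cardinality of the set $\mathcal{E}_n$ of isomorphism classes of Enriques diagrams of complexity $n$) is the Fibonacci number $F_{2n-4}$.
   Context: Fibonacci numbers: $F_0=0$, $F_1=1$, $F_{n+1}=F_n+F_{n-1}$ for $n\ge1$. A plane branch is a reduced irreducible germ $(C,O)$ of complex analytic curve on a germ $(\mathcal{S},O)$ of smooth complex analytic surface. A model over $(\mathcal{S},O)$ is a composition of finitely many blow-ups of points above $O$. An infinitely near point of $O$ is a point lying over $O$ on some model, two such points being identified when the bimeromorphic map between the models is an isomorphism near them. $E(P)$ denotes the exceptional curve created by blowing up $P$, and also its strict transforms. $Q$ is proximate to $P$ if $Q\in E(P)$. A point $\neq O$ is free if it is proximate to exactly one point, and satellite if it is proximate to two. The minimal embedded resolution of $(C,O)$ is obtained by repeatedly blowing up the unique point where the total transform of $C$ is not a normal crossing. Let $P_0=O,P_1,\dots,P_{n-1}$ be the points blown up, in order; $n$ is the blow-up complexity of $C$ ($n=0$ if $C$ is smooth, $n\ge3$ otherwise). Enriques diagram of $C$ (for $n\ge3$): the path graph with vertices $v_0,\dots,v_{n-1}$ (with $v_i$ corresponding to $P_i$) and edges $e_i=[v_{i-1}v_i]$, $1\le i\le n-1$, where each edge is decorated as curved or straight and each vertex as breaking or neutral, as follows. A straight path is a path of straight edges all of whose interior vertices are neutral; it is maximal if adding an adjacent edge never gives a straight path. (1) $e_i$ is curved iff $P_i$ is free. (2) If $P_{i+1},\dots,P_k$ are all the points of the sequence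 proximate to $P_i$ and $k\ge i+2$, then $[v_{i+1}v_k]$ is a maximal straight path, and if moreover $e_{i+1}$ is straight then $v_{i+1}$ is a breaking vertex. All other vertices are neutral. $\mathcal{E}_n$ is the set of isomorphism classes of Enriques diagrams of plane branches of blow-up complexity $n$. The combinatorial type of a plane branch is its Enriques diagram (this is equivalent to its embedded topological type). Always $e_1$ is curved, $e_{n-1}$ is straight and $v_0,v_1,v_{n-1}$ are neutral; a decoration with these properties is an Enriques diagram of complexity $n$ iff both edges adjacent to every breaking vertex are straight. *)

(* Defs.v *)
From mathcomp Require Import all_boot all_order all_algebra all_fingroup.
From mathcomp Require Import boolp reals.
From mathcomp.real_closed Require Import complex.

Set Implicit Arguments.
Unset Strict Implicit.
Unset Printing Implicit Defensive.

Import Order.TTheory GRing.Theory Num.Theory.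
Local Open Scope ring_scope.

Fixpoint fib (n : nat) : nat :=
  if n is n1.+1 then (if n1 is n2.+1 then fib n1 + fib n2 else 1)%N else 0%N.

(** Germs on a smooth surface.  Local coordinates (x, y) identify the local
    ring of the surface at a point with C{x,y}; [f i j] is the coefficient of
    x^i y^j. *)

Section Germs.
Variable R : realType.
Local Notation C := (R[i]).

Definition series := nat -> nat -> C.

(* Cauchy estimates.  In the partial order of R[i], [0 < r] forces r to be
   real. *)
Definition convergent (f : series) : Prop :=
  exists r M : C, 0 < r /\ forall i j, `|f i j| * r ^+ (i + j) <= M.

Definition sone : series := fun i j => ((i == 0%N) && (j == 0%N))%:R.

Definition smul (f g : series) : series := fun i j =>
  \sum_(a < i.+1) \sum_(b < j.+1) f a b * g (i - a)%N (j - b)%N.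

Definition sexp (f : series) (n : nat) : series := iter n (smul f) sone.

Definition vanishing (f : series) : Prop := f 0%N 0%N = 0.

(* Local equations of plane branches: irreducible elements of C{x,y}.  The
   units of C{x,y} are the non-vanishing germs; f = 0 is excluded because
   0 = 0 * 0. *)
Definition branch_equation (f : series) : Prop :=
  [/\ convergent f, vanishing f &
      forall g h, convergent g -> convergent h -> f = smul g h ->
        ~ vanishing g \/ ~ vanishing h].

Definition local_coordinates (u v : series) : Prop :=
  [/\ convergent u, convergent v, vanishing u, vanishing v &
      u 1%N 0%N * v 0%N 1%N - u 0%N 1%N * v 1%N 0%N != 0].

Definition normal_crossing (F : series) : Prop :=
  exists u v w a b, [/\ local_coordinates u v, convergent w, ~ vanishing w &
    F = smul w (smul (sexp u a) (sexp v b))].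

(** Infinitely near points.  The points of the exceptional curve of the blow-up
    of a point form a projective line, encoded as [option C]:
    - [Some c] is the tangent direction y = c x; there we use the coordinates
      (x', y') with x = x', y = x' (y' + c);
    - [None] is the tangent direction x = 0; there we use the coordinates
      (x', y') with x = x' y', y = y'.
    An infinitely near point of the origin is thus a sequence of directions,
    the first entry being the first one chosen. *)

Definition direction := option C.

Definition pullback (F : series) (q : direction) : series :=
  match q with
  | Some c => fun k l =>
      \sum_(j < k.+1) F (k - j)%N j * c ^+ (j - l) *+ 'C(j, l)
  | None => fun k l => if (k <= l)%N then F k (l - k)%N else 0
  end.

(* Local equation, at the point [d], of the total transform of f = 0. *)
Definition total_transform (f : series) (d : seq direction) : series :=
  foldl pullback f d.

(* In the coordinates above, the exceptional curves through a point are among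
   the two axes.  A pair [(a, b)] records that x = 0 is (the strict transform
   of) E(P_j) when [a = Some j], and is not exceptional when [a = None];
   likewise [b] for y = 0. *)
Definition axes := (option nat * option nat)%type.

(* Effect of blowing up P_i and moving to the direction [q].  For [Some c], the
   axis x' = 0 is E(P_i) and the strict transform y' = - c of y = 0 passes
   through the new point only if c = 0; for [None], the axis y' = 0 is E(P_i)
   and x' = 0 is the strict transform of x = 0. *)
Definition axes_step (i : nat) (ax : axes) (q : direction) : axes :=
  match q with
  | Some c => (Some i, if c == 0 then ax.2 else None)
  | None => (ax.1, Some i)
  end.

Fixpoint axes_from (i : nat) (ax : axes) (d : seq direction) : axes :=
  if d is q :: d' then axes_from i.+1 (axes_step i ax q) d' else ax.

(** A sequence [d] of n - 1 directions determines n points P_0, ..., P_{n-1}: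
    P_0 is the origin and P_k, given by [take k d], is in the first
    neighbourhood of P_{k-1}. *)

(* P_k is proximate to P_j: it lies on E(P_j). *)
Definition proximate (d : seq direction) (k j : nat) : bool :=
  let ax := axes_from 0 (None, None) (take k d) in
  (ax.1 == Some j) || (ax.2 == Some j).

Definition free_point (d : seq direction) (k : nat) : bool :=
  count (proximate d k) (iota 0 k) == 1%N.

(* P_0, ..., P_{size d} are the points blown up in the minimal embedded
   resolution of f = 0.  The points lying over the origin on the model obtained
   by blowing up P_0, ..., P_i are those of E(P_i) together with points at
   which the total transform was already known to be normal crossing. *)
Definition resolution_points (f : series) (d : seq direction) : Prop :=
  [/\ ~ normal_crossing f,
      forall (i : nat) (q : direction), (i < size d)%N ->
        (~ normal_crossing (total_transform f (rcons (take i d) q)) <->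
         q = nth None d i) &
      forall q : direction, normal_crossing (total_transform f (rcons d q))].

End Germs.

(** Decorated path graphs with n vertices v_0, ..., v_{n-1}.  The first tuple
    says which edges are straight, the edge of index i joining v_i and
    v_{i+1} (it is denoted e_{i+1}); the second one says which vertices are
    breaking. *)

Definition diagram (n : nat) := (n.-1.-tuple bool * n.-tuple bool)%type.

Section Diagrams.
Variable n : nat.
Implicit Types D : diagram n.

(* e_i is straight, for 1 <= i <= n - 1 *)
Definition straight D (i : nat) : bool := nth false D.1 i.-1.

Definition breaking D (i : nat) : bool := nth false D.2 i.

Definition straight_path D (a b : nat) : Prop :=
  [/\ (a <= b < n)%N,
      forall i, (a < i <= b)%N -> straight D i &
      forall i, (a < i < b)%N -> ~~ breaking D i].

Definition maximal_straight_path D (a b : nat) : Prop :=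
  [/\ straight_path D a b,
      (0 < a)%N -> ~ straight_path D a.-1 b &
      (b.+1 < n)%N -> ~ straight_path D a b.+1].

Definition edge_ends (e : 'I_n.-1) : {set 'I_n} :=
  [set v : 'I_n | (v == e :> nat) || (v == e.+1 :> nat)].

(* Isomorphisms of graphs which preserve the decorations. *)
Definition diagram_iso : rel (diagram n) := fun D D' =>
  [exists s : {perm 'I_n}, exists t : {perm 'I_n.-1},
    [&& [forall e, s @: edge_ends e == edge_ends (t e)],
        [forall e, tnth D'.1 (t e) == tnth D.1 e] &
        [forall v, tnth D'.2 (s v) == tnth D.2 v]]].

Variable R : realType.
Implicit Types d : seq (direction R).

(* P_{i+1}, ..., P_k are all the points among P_0, ..., P_{n-1} which are
   proximate to P_i. *)
Definition proximity_range d (i k : nat) : Prop :=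
  (i < n)%N /\ (k < n)%N /\
  forall j, (j < n)%N -> proximate d j i = (i < j <= k)%N.

Definition is_enriques_diagram d D : Prop :=
  [/\ forall i, (0 < i < n)%N -> ~~ straight D i = free_point d i,
      forall i k, proximity_range d i k -> (i.+2 <= k)%N ->
        maximal_straight_path D i.+1 k &
      forall v, (v < n)%N ->
        (breaking D v <->
         exists i k, [/\ v = i.+1, proximity_range d i k, (i.+2 <= k)%N &
                         straight D i.+1])].

Definition branch_diagram D : Prop :=
  exists (f : series R) d, [/\ branch_equation f, resolution_points f d,
    (size d).+1 = n & is_enriques_diagram d D].

End Diagrams.

(* The set of isomorphism classes of Enriques diagrams of plane branches of
   blow-up complexity n. *)
Definition enriques_classes (R : realType) (n : nat) : {set {set diagram n}} :=
  equivalence_partition (@diagram_iso n) [set D | `[< branch_diagram R D >]].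

(* Main.v *)
From HB Require Import structures.
Require Import Defs.
From mathcomp Require Import all_boot all_order all_algebra all_fingroup.
From mathcomp Require Import boolp reals.
From mathcomp.real_closed Require Import complex.
From mathcomp Require Import zify ring.

(** Pushing a branch forward under a blow-up: by Weierstrass preparation its equation can be taken
    to be a polynomial W of degree m in y, and x^m W (x, y / x - c) is then an irreducible germ
    downstairs with a single tangent line.  Since Weierstrass division is unique, the image of a
    factor of a strict transform divides the germ one started from; hence strict transforms of
    branches are branches, and a branch whose strict transform is transversal to the exceptional
    curve is smooth.  So the last point blown up cannot be free, and conversely every sequence of
    directions ending at a satellite point comes from the line y = x pushed forward along it.
    A diagram is therefore realized exactly when e_1 is curved, e_(n-1) is straight and both edges
    at each breaking vertex are straight; isomorphisms of such diagrams are trivial because the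
    reversal of the path exchanges e_1 and e_(n-1).  Reading pairs (v_i, e_(i+1)) from left to
    right, the numbers of completions after a curved and after a straight edge satisfy
    a' = a + b, b' = a + 2 b, the recursion of consecutive Fibonacci numbers. *)

Set Implicit Arguments.
Unset Strict Implicit.
Unset Printing Implicit Defensive.

Import Order.TTheory GRing.Theory Num.Theory.
Local Open Scope ring_scope.

(** * Formal power series *)

(** Irreducibility in [branch_equation] ranges over convergent factors, whereas division and
    inversion are constructed formally, coefficient by coefficient. Convergence is recovered
    afterwards by one majorant estimate, [convergent_quotient]. A germ is an element of [ps (ps C)],
    a series in x whose coefficients are series in y, so that [f 0] is f (0, y); this type is
    convertible to [series]. The charts [Some c] carry the analysis, since exchanging the
    coordinates reduces [None] to [Some 0]. Realizations end with the line y = x because it is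
    transversal to both axes: at a satellite point it forms a triple of concurrent smooth curves,
    and one more blow-up separates them. *)

Definition ps (A : Type) : Type := nat -> A.

HB.instance Definition _ (A : Type) := gen_eqMixin (ps A).
HB.instance Definition _ (A : Type) := gen_choiceMixin (ps A).

Section PsZmod.
Variable A : zmodType.
Implicit Types f g h : ps A.
Definition ps_add f g : ps A := fun n => f n + g n.
Definition ps_opp f : ps A := fun n => - f n.
Definition ps_zero : ps A := fun=> 0.
Fact ps_addA : associative ps_add.
Proof. by move=> f g h; apply/funext=> n; apply: addrA. Qed.
Fact ps_addC : commutative ps_add.
Proof. by move=> f g; apply/funext=> n; apply: addrC. Qed.
Fact ps_add0 : left_id ps_zero ps_add.
Proof. by move=> f; apply/funext=> n; apply: add0r. Qed.
Fact ps_addN : left_inverse ps_zero ps_opp ps_add.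
Proof. by move=> f; apply/funext=> n; apply: addNr. Qed.
HB.instance Definition _ :=
  GRing.isZmodule.Build (ps A) ps_addA ps_addC ps_add0 ps_addN.
End PsZmod.

Section PsTheoryZmod.
Variable A : zmodType.
Implicit Types f g h : ps A.
Lemma psD f g n : (f + g) n = f n + g n. Proof. by []. Qed.
Lemma psN f n : (- f) n = - f n. Proof. by []. Qed.
Lemma psB f g n : (f - g) n = f n - g n. Proof. by []. Qed.
Lemma ps0 n : (0 : ps A) n = 0. Proof. by []. Qed.
Lemma ps_sum (I : Type) (r : seq I) (P : pred I) (F : I -> ps A) n :
  (\sum_(i <- r | P i) F i) n = \sum_(i <- r | P i) F i n.
Proof. by elim/big_rec2: _ => // i y1 y2 _ <-. Qed.
End PsTheoryZmod.

Section PsRing.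
Variable A : comNzRingType.
Implicit Types f g h : ps A.
Definition ps_mul f g : ps A := fun n => \sum_(a < n.+1) f a * g (n - a)%N.
Definition psC (a : A) : ps A := fun n => if n is 0 then a else 0.
Definition psX : ps A := fun n => (n == 1%N)%:R.
Definition ps_one : ps A := fun n => (n == 0%N)%:R.

(* Coefficients of index at most n only depend on truncations, so that the ring axioms come
   from those of {poly A}. *)
Definition trunc n f : {poly A} := \poly_(i < n.+1) f i.
Lemma coef_trunc n f i : (i <= n)%N -> (trunc n f)`_i = f i.
Proof. by move=> lin; rewrite coef_poly ltnS lin. Qed.
Lemma ps_mul_trunc n f g i : (i <= n)%N ->
  (trunc n f * trunc n g)`_i = ps_mul f g i.
Proof.
move=> lin; rewrite coefM; apply: eq_bigr => j _.
have lji : (j <= i)%N by rewrite -ltnS.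
by rewrite !coef_trunc // ?(leq_trans lji) // (leq_trans _ lin) ?leq_subr.
Qed.
Lemma coefM_eq (p p' q q' : {poly A}) n :
  (forall i, (i <= n)%N -> p`_i = p'`_i) -> (forall i, (i <= n)%N -> q`_i = q'`_i) ->
  (p * q)`_n = (p' * q')`_n.
Proof.
move=> ep eq; rewrite !coefM; apply: eq_bigr => j _.
by rewrite ep ?eq ?leq_subr // -ltnS.
Qed.

Fact ps_mulC : commutative ps_mul.
Proof.
by move=> f g; apply/funext=> n; rewrite -!(ps_mul_trunc _ _ (leqnn n)) mulrC.
Qed.
Fact ps_mulA : associative ps_mul.
Proof.
move=> f g h; apply/funext=> n.
transitivity ((trunc n f * trunc n g * trunc n h)`_n).
  rewrite -mulrA -(ps_mul_trunc _ _ (leqnn n)).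
  by apply: coefM_eq => // i lin; rewrite coef_trunc // ps_mul_trunc.
rewrite -(ps_mul_trunc _ _ (leqnn n)).
by apply: coefM_eq => // i lin; rewrite coef_trunc // ps_mul_trunc.
Qed.
Fact ps_mul1 : left_id ps_one ps_mul.
Proof.
move=> f; apply/funext=> n; rewrite /ps_mul big_ord_recl mul1r subn0.
by rewrite big1 ?addr0 // => i _; rewrite mul0r.
Qed.
Fact ps_mulDl : left_distributive ps_mul (@ps_add A).
Proof.
move=> f g h; apply/funext=> n; rewrite /ps_mul /ps_add -big_split.
by apply: eq_bigr => i _; rewrite mulrDl.
Qed.
Fact ps_one_neq0 : ps_one != 0.
Proof. by apply/eqP=> /(congr1 (@^~ 0%N)) /eqP; rewrite /ps_one /= oner_eq0. Qed.
HB.instance Definition _ := GRing.Zmodule_isComNzRing.Build (ps A)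
  ps_mulA ps_mulC ps_mul1 ps_mulDl ps_one_neq0.

Lemma psM f g n : (f * g) n = \sum_(a < n.+1) f a * g (n - a)%N.
Proof. by []. Qed.
Lemma ps1 n : (1 : ps A) n = (n == 0%N)%:R. Proof. by []. Qed.
Lemma psM0 f g : (f * g) 0%N = f 0%N * g 0%N.
Proof. by rewrite psM big_ord_recl big_ord0 addr0. Qed.

Fact psC_zmod : zmod_morphism psC.
Proof. by move=> a b; apply/funext=> -[|n] //; rewrite /psC psB subr0. Qed.
Lemma psCM a f n : (psC a * f) n = a * f n.
Proof.
rewrite psM big_ord_recl subn0 big1 ?addr0 // => i _; exact: mul0r.
Qed.
Fact psC_monoid : monoid_morphism psC.
Proof.
split=> [|a b]; first by apply/funext=> -[].
by apply/funext=> n; rewrite psCM; case: n => //= n; rewrite mulr0.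
Qed.
HB.instance Definition _ := GRing.isZmodMorphism.Build A (ps A) psC psC_zmod.
HB.instance Definition _ := GRing.isMonoidMorphism.Build A (ps A) psC psC_monoid.

Lemma psXM f n : (psX * f) n = if n is n'.+1 then f n' else 0.
Proof.
rewrite psM big_ord_recl mul0r add0r.
case: n => [|n]; first by rewrite big_ord0.
rewrite big_ord_recl mul1r subSS subn0 big1 ?addr0 // => i _; exact: mul0r.
Qed.
Lemma psXnM m f n : (psX ^+ m * f) n = if (m <= n)%N then f (n - m)%N else 0.
Proof.
elim: m n => [|m IH] [|n]; rewrite ?mul1r // exprS -mulrA psXM //.
Qed.

Definition shift m f : ps A := fun n => f (n + m)%N.
Lemma shiftK m f : (forall i, (i < m)%N -> f i = 0) -> f = psX ^+ m * shift m f.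
Proof.
move=> f0; apply/funext=> n; rewrite psXnM /shift.
by case: leqP => [/subnK->|/f0].
Qed.

(** Strong recursion on coefficients: the k-th iterate of [Phi] is already stable at all indices
    below k, so the diagonal of the iterates is a fixed point. *)
Lemma ps_rec (T : Type) (x0 : T) (Phi : nat -> (nat -> T) -> T) :
  (forall n u v, (forall i, (i < n)%N -> u i = v i) -> Phi n u = Phi n v) ->
  exists u : nat -> T, forall n, u n = Phi n u.
Proof.
move=> ext; pose s k := iter k (fun u n => Phi n u) (fun=> x0).
have stab n k l : (n < k)%N -> (n < l)%N -> s k n = s l n.
  elim/ltn_ind: n k l => n IH [|k] [|l] // lk ll.
  by apply: ext => i lin; apply: IH => //; [exact: leq_trans lin lk|exact: leq_trans lin ll].
exists (fun n => s n.+1 n) => n /=.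
by apply: ext => i lin; exact: (stab i n i.+1).
Qed.

(** Units are defined by existence of an inverse because [A] is only a commutative ring here;
    [ps_unitE] later gives the criterion on the constant term. *)
Definition ps_unit : pred (ps A) := locked (fun f => `[< exists g, g * f = 1 >]).
Definition ps_inv : ps A -> ps A := locked (fun f =>
  if pselect (exists g, g * f = 1) is left P then projT1 (cid P) else f).
Fact ps_mulV : {in ps_unit, left_inverse 1 ps_inv *%R}.
Proof.
rewrite /ps_unit /ps_inv -!lock => f /asboolP Uf.
by case: pselect => // P; case: cid.
Qed.
Fact ps_unitP f g : g * f = 1 -> ps_unit f.
Proof. by move=> fg1; rewrite /ps_unit -lock; apply/asboolP; exists g. Qed.
Fact ps_invr_out : {in [predC ps_unit], ps_inv =1 id}.
Proof.
by rewrite /ps_unit /ps_inv -!lock => f /asboolP NUf; case: pselect.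
Qed.
HB.instance Definition _ := GRing.ComNzRing_hasMulInverse.Build (ps A)
  ps_mulV ps_unitP ps_invr_out.

End PsRing.
Arguments psX {A}.

Lemma ps_unitE (A : comUnitRingType) (f : ps A) :
  (f \is a GRing.unit) = (f 0%N \is a GRing.unit).
Proof.
apply/idP/idP => [Uf|Uf0].
  apply/unitrP; exists (f^-1 0%N).
  by rewrite -!psM0 mulVr // mulrV.
have [|g Eg] := @ps_rec A 0 (fun n u =>
   ((n == 0%N)%:R - \sum_(a < n) u a * f (n - a)%N) / f 0%N).
  move=> n u v euv; congr ((_ - _) / _); apply: eq_bigr => a _.
  by rewrite euv.
apply/unitrPr; exists g; rewrite mulrC; apply/funext=> n.
by rewrite psM big_ord_recr subnn /= [X in _ + X * _]Eg divrK // addrC subrK.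
Qed.

Section PsDomain.
Variable A : idomainType.
Lemma ps_lead (f : ps A) : f <> 0 ->
  exists2 m, f m != 0 & forall i, (i < m)%N -> f i = 0.
Proof.
move=> nz; have [|m fm min] := @ex_minnP (fun n => f n != 0).
  apply: contrapT => nex; apply: nz; apply/funext=> n; apply/eqP.
  by apply: contrapT => /negP fn; apply: nex; exists n.
exists m => // i lim; apply/eqP; apply: contraLR lim => /min.
by rewrite -leqNgt.
Qed.
Lemma psM_lead (f g : ps A) m n :
  (forall i, (i < m)%N -> f i = 0) -> (forall i, (i < n)%N -> g i = 0) ->
  (f * g) (m + n)%N = f m * g n.
Proof.
move=> f0 g0; rewrite (shiftK f0) (shiftK g0) mulrACA -exprD.
by rewrite !psXnM !leqnn !subnn psM0.
Qed.
Fact ps_idomain : GRing.integral_domain_axiom (ps A).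
Proof.
move=> f g fg0; apply: contraT; rewrite negb_or.
case/andP=> /eqP /ps_lead [m fm f0] /eqP /ps_lead [n gn g0].
have := psM_lead f0 g0; rewrite fg0 ps0 => /esym /eqP.
by rewrite mulf_eq0 (negPf fm) (negPf gn).
Qed.
HB.instance Definition _ := GRing.ComUnitRing_isIntegral.Build (ps A) ps_idomain.
End PsDomain.

(** * Convergence *)

(** The sum is T^(b-1) times a geometric sum of ratio K / T, at most 1/2. The factor T on the left
    avoids writing T^(b-1) when b = 0. *)
Lemma geometric_sum (K T b : nat) : (2 * K <= T)%N ->
  (T * (\sum_(k < b) K ^ k * T ^ (b.-1 - k)) <= 2 * T ^ b)%N.
Proof.
move=> KT; elim: b => [|b IH]; first by rewrite big_ord0 muln0.
rewrite big_ord_recl /= subn0 mul1n mulnDr -expnS.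
have -> : (\sum_(i < b) K ^ bump 0 i * T ^ (b - bump 0 i) =
           K * \sum_(i < b) K ^ i * T ^ (b.-1 - i))%N.
  rewrite big_distrr; apply: eq_bigr => i _ /=.
  by rewrite expnS mulnA /bump leq0n add1n subnS -predn_sub.
rewrite mulnCA mul2n -addnn leq_add2l.
apply: leq_trans (leq_mul (leqnn K) IH) _.
by rewrite mulnA (mulnC K) expnS leq_mul2r KT orbT.
Qed.

Section Convergence.
Variable R : realType.
Local Notation C := (R[i]).
Local Notation S := (ps (ps C)).
Implicit Types f g h q : S.

(** One natural number carries both the radius and the constant of a Cauchy estimate, the extra
    power absorbing the constant. Majorants thus become inequalities in [nat]. *)
Definition bounded (K : nat) f := forall i j, `|f i j| <= (K ^ (i + j).+1)%:R.

(** The order of R[i] is only partial, so the archimedean property is borrowed from R. *)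
Lemma norm_natP (z : C) : exists n : nat, `|z| <= n%:R.
Proof.
have /complex_realP[k Ek] := normr_real z.
exists (Num.bound k); rewrite Ek.
have -> : (Num.bound k)%:R = (Num.bound k)%:R%:C%C :> C by rewrite rmorph_nat.
by rewrite lecR ltW // archi_boundP // -lecR -Ek normr_ge0.
Qed.

Lemma boundedW K L f : (K <= L)%N -> bounded K f -> bounded L f.
Proof.
by move=> KL fK i j; apply: le_trans (fK i j) _; rewrite ler_nat leq_exp2r.
Qed.

Lemma convergentP f : convergent f <-> exists2 K, (0 < K)%N & bounded K f.
Proof.
split=> [[r [M [r0 fM]]]|[K K0 fK]].
  have [m] := norm_natP M; have [k Hk] := norm_natP r^-1.
  have M0 : 0 <= M by apply: le_trans (fM 0%N 0%N); rewrite mulr_ge0 ?exprn_ge0 // ltW.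
  rewrite ger0_norm // => Hm.
  exists (m + k).+1 => // i j.
  have rk : r^-1 <= (m + k).+1%:R.
    by apply: le_trans (le_trans (real_ler_norm _) Hk) _; rewrite ?ler_nat ?gtr0_real ?invr_gt0 //; lia.
  have -> : `|f i j| = `|f i j| * r ^+ (i + j) * r^-1 ^+ (i + j).
    by rewrite exprVn mulfK // expf_neq0 // gt_eqF.
  rewrite expnS natrM natrX; apply: ler_pM.
  - by rewrite mulr_ge0 ?exprn_ge0 // ltW.
  - by rewrite exprn_ge0 // invr_ge0 ltW.
  - apply: le_trans (fM i j) _; apply: le_trans Hm _.
    by rewrite ler_nat; lia.
  - by apply: lerXn2r => //; rewrite nnegrE ?ler0n // invr_ge0 ltW.
have KR0 : 0 < K%:R :> C by rewrite ltr0n.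
exists K%:R^-1, K%:R; split=> [|i j]; first by rewrite invr_gt0.
by rewrite exprVn ler_pdivrMr ?exprn_gt0 // -natrX -natrM -expnS.
Qed.

Lemma convergent2 f g : convergent f -> convergent g ->
  exists K, [/\ (0 < K)%N, bounded K f & bounded K g].
Proof.
move=> /convergentP[K K0 fK] /convergentP[L L0 gL].
by exists (maxn K L); split; [rewrite leq_max K0|apply: boundedW fK|apply: boundedW gL];
  rewrite ?leq_maxl ?leq_maxr.
Qed.

Lemma convergent0 : convergent (0 : S).
Proof. by apply/convergentP; exists 1%N => // i j; rewrite normr0 ler0n. Qed.

Lemma convergentN f : convergent f -> convergent (- f).
Proof. by move=> [r [M [r0 fM]]]; exists r, M; split=> // i j; rewrite normrN. Qed.

Lemma convergentD f g : convergent f -> convergent g -> convergent (f + g).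
Proof.
move=> cf cg; have [K [K0 fK gK]] := convergent2 cf cg.
apply/convergentP; exists (2 * K)%N => [|i j]; first by rewrite muln_gt0.
apply: le_trans (ler_normD _ _) _; apply: le_trans (lerD (fK i j) (gK i j)) _.
rewrite -natrD ler_nat addnn -mul2n expnMn leq_mul2r.
by rewrite -{1}(expn1 2) leq_exp2l // orbT.
Qed.

Lemma convergentB f g : convergent f -> convergent g -> convergent (f - g).
Proof. by move=> cf cg; apply: convergentD => //; apply: convergentN. Qed.

Lemma convergent_sum (I : Type) (r : seq I) (P : pred I) (F : I -> S) :
  (forall i, convergent (F i)) -> convergent (\sum_(i <- r | P i) F i).
Proof.
move=> cF; elim/big_rec: _ => [|i f _]; [exact: convergent0|exact: convergentD].
Qed.

(* The Cauchy sum has (i + 1)(j + 1) <= 2^(i + j) terms. *)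
Lemma convergentM f g : convergent f -> convergent g -> convergent (f * g).
Proof.
move=> cf cg; have [K [K0 fK gK]] := convergent2 cf cg.
apply/convergentP; exists (2 * (K * K))%N => [|i j]; first by rewrite !muln_gt0 K0.
rewrite psM ps_sum; apply: le_trans (ler_norm_sum _ _ _) _.
have -> : ((2 * (K * K)) ^ (i + j).+1)%N = (2 ^ (i + j).+1 * K ^ ((i + j).+1 + (i + j).+1))%N.
  by rewrite !expnMn expnD.
apply: (@le_trans _ _ (\sum_(a < i.+1) \sum_(b < j.+1) (K ^ ((i + j).+1 + (i + j).+1))%:R)).
  apply: ler_sum => a _; rewrite psM; apply: le_trans (ler_norm_sum _ _ _) _.
  apply: ler_sum => b _; rewrite normrM.
  apply: le_trans (ler_pM _ _ (fK _ _) (gK _ _)) _ => //.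
  rewrite -natrM -expnD ler_nat leq_pexp2l //.
  by have := ltn_ord a; have := ltn_ord b; lia.
rewrite !sumr_const !card_ord -!mulrnA ler_nat mulnC leq_mul2r; apply/orP; right.
have := leq_mul (ltn_expl i (isT : 1 < 2)%N) (ltn_expl j (isT : 1 < 2)%N).
rewrite -expnD mulnC => /leq_trans; apply; exact: leq_pexp2l.
Qed.

End Convergence.

(** Here B U^i T^b is the intended bound on the coefficient [q i b] of a quotient. The three
    summands come from the dividend, from the rest of the row [f 0], and from the other rows of f;
    the constants make them at most 1/2, 1/4 and 1/4 of the right-hand side. *)
Lemma division_bound (K L T U B m i b : nat) : (0 < T)%N ->
  (2 * K <= T)%N -> (8 * L * K ^ m.+2 <= T)%N ->
  (2 * K <= U)%N -> (16 * L * K ^ 2 * T ^ m <= U)%N ->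
  B = (2 * L * K ^ m.+1)%N ->
  (L * (K ^ (i + (b + m)).+1
     + \sum_(k < b) K ^ (m + k).+2 * (B * U ^ i * T ^ (b.-1 - k))
     + \sum_(a < i) \sum_(c < (b + m).+1)
          K ^ (a.+1 + c).+1 * (B * U ^ (i.-1 - a) * T ^ (b + m - c)))
   <= B * U ^ i * T ^ b)%N.
Proof.
move=> T0 KT T8 KU U16 EB.
have G1 := geometric_sum b KT; have G2 := geometric_sum i KU.
have := geometric_sum (b + m).+1 KT; rewrite expnS mulnCA leq_pmul2l //= => G3.
set s1 := (X in (_ + X + _)%N); set s2 := (X in (_ + _ + X)%N).
set g1 := (\sum_(k < b) _)%N in G1; set g2 := (\sum_(k < i) _)%N in G2.
set g3 := (\sum_(k < _) _)%N in G3.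
have -> : s1 = (K ^ m.+2 * B * U ^ i * g1)%N.
  rewrite /s1 /g1 big_distrr; apply: eq_bigr => k _ /=.
  rewrite -!addSn expnD; nia.
have -> : s2 = (K ^ 2 * B * g2 * g3)%N.
  rewrite /s2 /g2 /g3 -mulnA big_distrl big_distrr; apply: eq_bigr => a _ /=.
  rewrite !big_distrr; apply: eq_bigr => c _ /=.
  have -> : ((a.+1 + c).+1 = 2 + a + c)%N by lia.
  by rewrite !expnD; nia.
have mono e x y : (x <= y)%N -> (x ^ e <= y ^ e)%N by case: e => // e; rewrite leq_exp2r.
have KTb : (K ^ b <= T ^ b)%N by apply: mono; lia.
have KUi : (K ^ i <= U ^ i)%N by apply: mono; lia.
have -> : (K ^ (i + (b + m)).+1 = K ^ m.+1 * (K ^ i * K ^ b))%N.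
  by rewrite -!expnD; congr expn; lia.
rewrite expnD in G3.
have E1 : (L * (K ^ m.+1 * (K ^ i * K ^ b)) * 2 <= B * U ^ i * T ^ b)%N.
  rewrite (_ : (_ * 2)%N = (B * (K ^ i * K ^ b))%N); last by rewrite EB; nia.
  by rewrite -mulnA leq_mul2l leq_mul ?orbT.
have E2 : (L * (K ^ m.+2 * B * U ^ i * g1) * 8 <= B * U ^ i * (2 * T ^ b))%N.
  apply: leq_trans (leq_mul (leqnn _) G1).
  apply: leq_trans (leq_mul (leqnn _) (leq_mul T8 (leqnn _))).
  by nia.
have E3 : (L * (K ^ 2 * B * g2 * g3) * 8 <= 2 * (B * U ^ i * T ^ b))%N.
  apply: (@leq_trans (L * (K ^ 2 * B * g2 * (2 * (T ^ b * T ^ m))) * 8)%N).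
    by rewrite !leq_mul.
  have -> : (2 * (B * U ^ i * T ^ b) = B * T ^ b * (2 * U ^ i))%N by nia.
  apply: leq_trans (leq_mul (leqnn _) G2).
  apply: leq_trans (leq_mul (leqnn _) (leq_mul U16 (leqnn _))).
  by nia.
rewrite !mulnDr; set t1 := (L * _)%N in E1 *; set t2 := (L * _)%N in E2 *.
set t3 := (L * _)%N in E3 *; move: E2; rewrite mulnCA; lia.
Qed.

Section Division.
Variable R : realType.
Local Notation C := (R[i]).
Local Notation S := (ps (ps C)).
Implicit Types f g h q : S.

(* The coefficients of order at least [m] in y of [f * q = g + r], with r of degree < m in y,
   determine q; the weights U^i T^b dominate it when T is large, and U larger still. *)
Lemma convergent_quotient f g q m :
  convergent f -> convergent g ->
  (forall c, (c < m)%N -> f 0%N c = 0) -> f 0%N m != 0 ->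
  (forall i b, (f * q) i (b + m)%N = g i (b + m)%N) -> convergent q.
Proof.
move=> cf cg f0 fm Efq; have [K [K0 fK gK]] := convergent2 cf cg.
have [L' HL'] := norm_natP (f 0%N m)^-1; pose L := L'.+1.
have HL : `|(f 0%N m)^-1| <= L%:R by apply: le_trans HL' _; rewrite ler_nat.
(* The smallest values that [division_bound] allows. *)
pose T := (8 * L * K ^ m.+2)%N; pose U := (16 * L * K ^ 2 * T ^ m)%N.
pose B := (2 * L * K ^ m.+1)%N.
have T0 : (0 < T)%N by rewrite /T muln_gt0 expn_gt0 K0.
have KT : (2 * K <= T)%N.
  by rewrite /T expnS; have : (0 < L * K ^ m.+1)%N; [rewrite muln_gt0 expn_gt0 K0|nia].
have KU : (2 * K <= U)%N.
  by rewrite /U expnS; have : (0 < L * K ^ 1 * T ^ m)%N; [rewrite !muln_gt0 !expn_gt0 K0 T0|nia].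
(* Lexicographic induction: besides f 0 m * q i b, the coefficient of f * q at (i, b + m) only
   involves earlier rows of q and earlier entries of its row i. *)
have qB i b : `|q i b| <= (B * U ^ i * T ^ b)%:R.
  elim/ltn_ind: i b => i IHi; elim/ltn_ind=> b IHb.
  have Eq : f 0%N m * q i b = g i (b + m)%N
     - \sum_(k < b) f 0%N (m + k).+1 * q i (b.-1 - k)%N
     - \sum_(a < i) \sum_(c < (b + m).+1) f a.+1 c * q (i.-1 - a)%N (b + m - c)%N.
    rewrite -Efq psM ps_sum big_ord_recl subn0 psM; set s := (X in _ = _ + X - _ - _).
    rewrite -[in \sum_(_ < (b + m).+1) _](addnC m) -addnS big_split_ord /= big1 ?add0r; last first.
      by move=> c _; rewrite f0 ?mul0r.
    rewrite big_ord_recl addn0 (addnC m) addnK.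
    have -> : s = \sum_(a < i) \sum_(c < (b + m).+1) f a.+1 c * q (i.-1 - a)%N (b + m - c)%N.
      apply: eq_bigr => a _; rewrite psM /= /bump leq0n add1n.
      by apply: eq_bigr => c _; rewrite subnS -predn_sub.
    have cancel (x y z t : C) : y = z -> x = x + y + t - z - t by move->; ring.
    apply: cancel.
    apply: eq_bigr => k _; rewrite /= /bump leq0n add1n addnS.
    by congr (_ * q _ _); have := ltn_ord k; lia.
  have -> : q i b = (f 0%N m)^-1 * (f 0%N m * q i b) by rewrite mulKf.
  rewrite Eq normrM.
  have := @division_bound K L T U B m i b T0 KT (leqnn _) KU (leqnn _) erefl.
  rewrite -(ler_nat C); apply: le_trans.
  rewrite natrM ler_pM // -addrA -opprD; apply: le_trans (ler_normB _ _) _.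
  rewrite -addnA 2!natrD; apply: lerD; first exact: gK.
  apply: le_trans (ler_normD _ _) _; rewrite !natr_sum; apply: lerD.
    apply: le_trans (ler_norm_sum _ _ _) _; apply: ler_sum => k _.
    rewrite normrM natrM; apply: ler_pM => //.
    by apply: IHb; have := ltn_ord k; lia.
  apply: le_trans (ler_norm_sum _ _ _) _; apply: ler_sum => a _; rewrite natr_sum.
  apply: le_trans (ler_norm_sum _ _ _) _; apply: ler_sum => c _.
  rewrite normrM natrM; apply: ler_pM => //.
  by apply: IHi; have := ltn_ord a; lia.
apply/convergentP; exists (maxn B (maxn T U)) => [|i b].
  by rewrite !leq_max T0 orbT.
apply: le_trans (qB i b) _; rewrite ler_nat expnS expnD -mulnA.
have mono e x y : (x <= y)%N -> (x ^ e <= y ^ e)%N by case: e => // e; rewrite leq_exp2r.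
by rewrite !leq_mul ?leq_maxl // mono // !leq_max leqnn ?orbT.
Qed.

Lemma convergentV f : convergent f -> f \is a GRing.unit -> convergent f^-1.
Proof.
move=> cf Uf; apply: (@convergent_quotient f 1 _ 0) => // [||i b]; last by rewrite divrr.
  by apply/convergentP; exists 1%N => // -[|i] [|j]; rewrite !ps1 ?normr0 ?normr1 ?exp1n.
by move: Uf; rewrite !ps_unitE unitfE.
Qed.

End Division.

(** * Blowing up *)

Section Regrading.
Variable A : comNzRingType.
Local Notation S := (ps (ps A)).
Implicit Types f g : S.

(** Exchange of the coordinates, which turns the direction x = 0 into y = 0. *)
Definition swap f : S := fun i j => f j i.

Lemma swapK : involutive swap. Proof. by []. Qed.
Fact swap_zmod : zmod_morphism swap. Proof. by []. Qed.
Lemma psM2 f g i j :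
  (f * g) i j = \sum_(a < i.+1) \sum_(b < j.+1) f a b * g (i - a)%N (j - b)%N.
Proof. by rewrite psM ps_sum. Qed.
Fact swap_monoid : monoid_morphism swap.
Proof.
split=> [|f g]; apply/funext=> i; apply/funext=> j; first by case: i j => [|i] [].
by rewrite /swap !psM2 exchange_big.
Qed.
HB.instance Definition _ := GRing.isZmodMorphism.Build S S swap swap_zmod.
HB.instance Definition _ := GRing.isMonoidMorphism.Build S S swap swap_monoid.

(* [homog f k] is the dehomogenization y = 1 of the part of degree k of f, with y as variable:
   f (x, x z) = \sum_k x^k (homog f k)(z). *)
Definition homog f : ps {poly A} := fun k => \poly_(j < k.+1) f (k - j)%N j.

Lemma coef_homog f k j : (homog f k)`_j = if (j <= k)%N then f (k - j)%N j else 0.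
Proof. by rewrite coef_poly ltnS. Qed.
Lemma size_homog f k : (size (homog f k) <= k.+1)%N. Proof. exact: size_poly. Qed.

Fact homog_zmod : zmod_morphism homog.
Proof.
move=> f g; apply/funext=> k; apply/polyP=> j; rewrite psB coefB !coef_homog.
by case: ifP => //; rewrite subr0.
Qed.
Fact homog_monoid : monoid_morphism homog.
Proof.
split=> [|f g]; apply/funext=> k; apply/polyP=> j; rewrite coef_homog.
  rewrite !ps1; case: k => [|k]; first by rewrite coef1; case: j.
  by rewrite coef0; case: leqP => // _; case: eqP => // /eqP; case: j.
rewrite [in RHS]psM coef_sum; under [RHS]eq_bigr do rewrite coefM.
rewrite exchange_big /=; under [RHS]eq_bigr => b _.
  under eq_bigr do rewrite !coef_homog. over.
case: leqP => [jk|kj]; last first.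
  rewrite big1 // => b _; rewrite big1 // => k1 _.
  case: leqP => // bk; last by rewrite mul0r.
  by case: leqP => // jb; [have := ltn_ord k1; lia|rewrite mulr0].
rewrite psM2 exchange_big; apply: eq_bigr => b _; have bj : (b <= j)%N by rewrite -ltnS.
pose F a := f a b * g (k - j - a)%N (j - b)%N.
pose G a := (if (b <= a)%N then f (a - b)%N b else 0) *
   (if (j - b <= k - a)%N then g (k - a - (j - b))%N (j - b)%N else 0).
rewrite -(big_mkord xpredT F) -(big_mkord xpredT G).
(* Only b <= a <= k - j + b contributes; elsewhere one of the two homogeneous parts has no
   coefficient at the required index. *)
rewrite [in RHS](@big_cat_nat _ _ _ b) /=; [|lia..].
rewrite (@big_cat_nat _ _ _ (k - j + b).+1 b) /=; [|lia..].
have -> : \sum_(0 <= a < b) G a = 0.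
  by rewrite big_nat big1 // => a /andP[_ ab]; rewrite /G leqNgt ab mul0r.
have -> : \sum_((k - j + b).+1 <= a < k.+1) G a = 0.
  by rewrite big_nat big1 // => a /andP[ab ak]; rewrite /G [X in _ * X]ifF ?mulr0 //; lia.
rewrite add0r addr0 -[X in \sum_(X <= _ < _) G _]add0n big_addn -addSn addnK.
apply: eq_big_nat => a /andP[_ ak].
rewrite /F /G leq_addl addnK ifT; last by lia.
by congr (_ * g _ _); lia.
Qed.
HB.instance Definition _ := GRing.isZmodMorphism.Build S (ps {poly A}) homog homog_zmod.
HB.instance Definition _ := GRing.isMonoidMorphism.Build S (ps {poly A}) homog homog_monoid.

Lemma homog_inj : injective homog.
Proof.
move=> f g E; apply/funext=> i; apply/funext=> j.
have := congr1 (fun h : ps {poly A} => (h (i + j)%N)`_j) E.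
by rewrite !coef_homog leq_addl addnK.
Qed.

Definition translate (c : A) (p : {poly A}) : ps A := fun l => (p \Po ('X + c%:P))`_l.
Fact translate_zmod c : zmod_morphism (translate c).
Proof. by move=> p q; apply/funext=> l; rewrite /translate raddfB coefB. Qed.
Fact translate_monoid c : monoid_morphism (translate c).
Proof.
split=> [|p q]; apply/funext=> l; rewrite /translate ?rmorph1 ?coef1 //.
by rewrite rmorphM coefM.
Qed.
HB.instance Definition _ c :=
  GRing.isZmodMorphism.Build {poly A} (ps A) (translate c) (translate_zmod c).
HB.instance Definition _ c :=
  GRing.isMonoidMorphism.Build {poly A} (ps A) (translate c) (translate_monoid c).

Lemma translate0 c p : translate c p 0%N = p.[c].
Proof. by rewrite /translate -horner_coef0 horner_comp !hornerE. Qed.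

Lemma translate_inj c : injective (translate c).
Proof.
move=> p q E; have {}E : p \Po ('X + c%:P) = q \Po ('X + c%:P).
  by apply/polyP=> l; apply: (congr1 (@^~ l) E).
have Ec r : (r \Po ('X + c%:P)) \Po ('X - c%:P) = r :> {poly A}.
  by rewrite -comp_polyA comp_polyD comp_polyX comp_polyC subrK comp_polyXr.
by rewrite -[p]Ec E Ec.
Qed.
End Regrading.

Section Pullback.
Variable R : realType.
Local Notation C := (R[i]).
Local Notation S := (ps (ps C)).
Implicit Types (f g : S) (q : direction R).

Definition pull q f : S := pullback f q.

(** The substitution y = x (y' + c) splits into grading by degree and expansion at c. Both are
    injective ring morphisms, which gives multiplicativity and injectivity of the pullback. *)
Lemma pull_some c f k : pull (Some c) f k = translate c (homog f k).
Proof.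
apply/funext=> l; rewrite /pull /= /translate /homog poly_def linear_sum coef_sum.
apply: eq_bigr => j _ /=; rewrite linearZ /= coefZ -mulrnAr; congr (_ * _).
rewrite comp_Xn_poly addrC exprDn_comm; last exact: commr_polyX.
rewrite coef_sum; under eq_bigr do rewrite coefMn -polyC_exp coefCM coefXn mulrnAr.
have [lj|jl] := leqP l j.
  rewrite (bigD1 (inord l)) //= inordK // eqxx mulr1 big1 ?addr0 // => i /eqP il.
  by case: eqP => [li|]; rewrite ?mulr0 ?mul0rn //; case: il; apply/val_inj; rewrite /= inordK.
by rewrite bin_small // big1 // => i _; case: eqP => [li|]; rewrite ?mulr0 ?mul0rn //; have := ltn_ord i; lia.
Qed.

Lemma pull_none f : pull None f = swap (pull (Some 0) (swap f)).
Proof.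
apply/funext=> k; apply/funext=> l; rewrite /swap pull_some.
rewrite /translate addr0 comp_polyXr coef_homog /pull /=; by [].
Qed.

End Pullback.
Arguments pull : simpl never.

Section PullbackMorphism.
Variable R : realType.
Local Notation C := (R[i]).
Local Notation S := (ps (ps C)).
Implicit Types (f g : S) (q : direction R).

Fact pull_zmod q : zmod_morphism (@pull R q).
Proof.
have some c : zmod_morphism (@pull R (Some c)).
  by move=> f g; apply/funext=> k; rewrite psB !pull_some rmorphB psB rmorphB.
by case: q => [c|f g]; [exact: some|rewrite !pull_none !(rmorphB, some)].
Qed.
Fact pull_monoid q : monoid_morphism (@pull R q).
Proof.
have some c : monoid_morphism (@pull R (Some c)).
  split=> [|f g]; apply/funext=> k; rewrite pull_some ?rmorph1 ?rmorphM.
    by rewrite !ps1; case: eqP; rewrite ?rmorph1 ?rmorph0.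
  by rewrite !psM rmorph_sum; apply: eq_bigr => a _; rewrite rmorphM !pull_some.
case: q => [c|]; first exact: some.
by split=> [|f g]; rewrite !pull_none ?rmorph1 ?rmorphM ?(some 0).1 ?(some 0).2 ?rmorph1 ?rmorphM.
Qed.
HB.instance Definition _ q := GRing.isZmodMorphism.Build S S (@pull R q) (pull_zmod q).
HB.instance Definition _ q := GRing.isMonoidMorphism.Build S S (@pull R q) (pull_monoid q).

Definition varx : S := psX.
Definition vary : S := psC psX.
Definition cst (c : C) : S := psC (psC c).

Lemma swap_varx : swap varx = vary.
Proof. by apply/funext=> i; apply/funext=> j; rewrite /swap /varx /vary /psX /psC; case: i j => [|i] [|[|j]]. Qed.
Lemma swap_vary : swap vary = varx. Proof. by rewrite -swap_varx. Qed.

Lemma varxE m f i j : (varx ^+ m * f) i j = if (m <= i)%N then f (i - m)%N j else 0.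
Proof. by rewrite psXnM; case: ifP. Qed.
Lemma varyE m f i j : (vary ^+ m * f) i j = if (m <= j)%N then f i (j - m)%N else 0.
Proof. by rewrite -rmorphXn psCM psXnM. Qed.
Lemma psX_b (A : comNzRingType) (b : bool) j : (b%:R : ps A) j = (b && (j == 0%N))%:R.
Proof. by case: b. Qed.
Lemma coef_b (b : bool) j : (b%:R : {poly C})`_j = (b && (j == 0%N))%:R.
Proof. by case: b; [exact: coef1|exact: coef0]. Qed.
Lemma homog_varx : homog varx = psX.
Proof.
apply/funext=> k; apply/polyP=> j.
have Ex (A : comNzRingType) n : (psX : ps A) n = (n == 1%N)%:R by [].
rewrite coef_homog /varx !Ex coef_b psX_b.
by case: j => [|j]; rewrite ?subn0 ?andbF ?if_same.
Qed.
Lemma homog_vary : homog vary = psX * psC 'X.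
Proof.
apply/funext=> k; apply/polyP=> j; rewrite coef_homog psXM /vary.
case: k => [|k]; first by rewrite coef0; case: ifP => //; case: j.
case: k => [|k] /=; rewrite ?coefX ?coef0; case: ifP => //; case: j => [|[|j]] //= _.
by rewrite subSS; case: subn.
Qed.
Lemma pull_some_varx c : pull (Some c) varx = varx.
Proof.
apply/funext=> k; rewrite pull_some homog_varx /psX rmorph_nat; done.
Qed.
Lemma pull_some_vary c : pull (Some c) vary = varx * (vary + cst c).
Proof.
apply/funext=> k; rewrite pull_some homog_vary !psXM.
case: k => [|[|k]]; [exact: rmorph0| |rewrite rmorph0 psD /vary /cst /= addr0 //].
apply/funext=> l; rewrite /translate comp_polyX coefD coefX coefC.
by rewrite !psD /vary /cst /= /psC; case: l.
Qed.
Lemma pull_none_varx : pull None varx = varx * vary.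
Proof.
by rewrite pull_none swap_varx pull_some_vary /cst !rmorph0 addr0 rmorphM /= swap_varx swap_vary mulrC.
Qed.
Lemma pull_none_vary : pull None vary = vary.
Proof. by rewrite pull_none swap_vary pull_some_varx swap_varx. Qed.

Lemma pull_some_inj c : injective (@pull R (Some c)).
Proof.
move=> f g E; apply: homog_inj; apply/funext=> k; apply: (@translate_inj _ c).
by rewrite -!pull_some E.
Qed.

Lemma pull00 q f : pull q f 0%N 0%N = f 0%N 0%N.
Proof.
have some c g : pull (Some c) g 0%N 0%N = g 0%N 0%N.
  rewrite pull_some translate0 /homog horner_poly big_ord_recl big_ord0 /= addr0 expr0 mulr1; done.
by case: q => [c|]; rewrite ?some // pull_none /swap some.
Qed.

Lemma convergent_swap f : convergent f -> convergent (swap f).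
Proof.
by move=> /convergentP[K K0 fK]; apply/convergentP; exists K => // i j; rewrite /swap addnC.
Qed.

Lemma convergent_pull q f : convergent f -> convergent (pull q f).
Proof.
suff some c g : convergent g -> convergent (pull (Some c) g).
  case: q => [c|] cf; rewrite ?pull_none; first exact: some.
  by apply: convergent_swap; apply: some; apply: convergent_swap.
move=> /convergentP[K K0 gK]; have [D' HD'] := norm_natP c.
have HD : `|c| <= D'.+1%:R by apply: le_trans HD' _; rewrite ler_nat.
move: D'.+1 HD (ltn0Sn D') => D HD D0.
(* D bounds c; each binomial is at most 2^k and there are k + 1 <= 2^k terms, hence the factor 4. *)
apply/convergentP; exists (4 * D * K)%N => [|k l]; first by rewrite !muln_gt0 D0 K0.
rewrite /pull /=; apply: le_trans (ler_norm_sum _ _ _) _.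
apply: (@le_trans _ _ (\sum_(j < k.+1) (K ^ k.+1 * D ^ k * 2 ^ k)%:R)).
  apply: ler_sum => j _; have jk : (j <= k)%N by rewrite -ltnS.
  rewrite normrMn normrM normrX -[leLHS]mulr_natr 2!natrM; apply: ler_pM => //.
  - by rewrite mulr_ge0 // exprn_ge0.
  - apply: ler_pM => //; first by rewrite exprn_ge0.
      by apply: le_trans (gK _ _) _; rewrite subnK.
    apply: (@le_trans _ _ (D%:R ^+ (j - l))); first by apply: lerXn2r; rewrite ?nnegrE.
    by rewrite -natrX ler_nat leq_pexp2l //; lia.
  rewrite ler_nat; apply: (@leq_trans (2 ^ j)%N); last by rewrite leq_pexp2l.
  rewrite -[2%N]/(1 + 1)%N expnDn; have [lj|jl] := leqP l j; last by rewrite bin_small.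
  by rewrite (bigD1 (Ordinal (lj : l < j.+1)%N)) //= !exp1n !muln1 leq_addr.
rewrite sumr_const card_ord -mulrnA ler_nat.
have k2 := ltn_expl k (isT : 1 < 2)%N.
apply: leq_trans (leq_mul (leqnn _) k2) _; rewrite -mulnA -expnMn.
rewrite (_ : (K ^ k.+1 * D ^ k * (2 * 2) ^ k = K * (4 * D * K) ^ k)%N); last first.
  rewrite expnS -[(2 * 2)%N]/4%N !(expnMn _ K) !(expnMn _ D); nia.
apply: (@leq_trans ((4 * D * K) ^ k.+1)).
  by rewrite expnS leq_mul // leq_pmull // muln_gt0 D0.
by rewrite leq_pexp2l ?ltnS ?leq_addr // !muln_gt0 D0 K0.
Qed.

Lemma convergent_bounded1 f : (forall i j, `|f i j| <= 1) -> convergent f.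
Proof. by move=> f1; apply/convergentP; exists 1%N => // i j; rewrite exp1n. Qed.
Lemma convergent1 : convergent (1 : S).
Proof.
by apply: convergent_bounded1 => i j; rewrite ps1 psX_b normr_nat lern1 leq_b1.
Qed.
Lemma convergent_varx : convergent varx.
Proof.
apply: convergent_bounded1 => i j.
have -> : varx i j = ((i == 1%N) && (j == 0%N))%:R by apply: psX_b.
by rewrite normr_nat lern1 leq_b1.
Qed.
Lemma convergent_vary : convergent vary.
Proof. by rewrite -swap_varx; apply/convergent_swap/convergent_varx. Qed.
Lemma convergent_cst c : convergent (cst c).
Proof.
have [D HD] := norm_natP c; apply/convergentP; exists D.+1 => // i j.
apply: le_trans (_ : `|c| <= _); first by rewrite /cst /psC; case: i j => [|i] [|j]; rewrite ?normr0.
by apply: le_trans HD _; rewrite ler_nat expnS; have : (0 < D.+1 ^ (i + j))%N; [rewrite expn_gt0|nia].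
Qed.
Lemma convergentX f n : convergent f -> convergent (f ^+ n).
Proof.
by move=> cf; elim: n => [|n IH]; [exact: convergent1|rewrite exprS; apply: convergentM].
Qed.
Lemma convergent_shift m f : convergent (varx ^+ m * f) -> convergent f.
Proof.
move=> /convergentP[K K0 fK]; apply/convergentP; exists (K ^ m.+1)%N => [|i j].
  by rewrite expn_gt0 K0.
have := fK (i + m)%N j; rewrite varxE leq_addl addnK => /le_trans; apply.
by rewrite ler_nat -expnM leq_pexp2l //; nia.
Qed.
End PullbackMorphism.
Arguments varx {R}. Arguments vary {R}.

(** * Weierstrass division *)

Section Weierstrass.
Variable R : realType.
Local Notation C := (R[i]).
Local Notation S := (ps (ps C)).
Implicit Types (f g h W : S).

(** Weierstrass regularity in y: f (0, y) vanishes to order exactly m. *)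
Definition regular m f := f 0%N m != 0 /\ forall c, (c < m)%N -> f 0%N c = 0.

Definition low_degree m f := forall i b, (m <= b)%N -> f i b = 0.

Lemma regularP f : f 0%N <> 0 -> exists m, regular m f.
Proof. by case/ps_lead => m fm f0; exists m. Qed.

Lemma regular_psX m f : regular m f -> exists2 e : ps C, e \is a GRing.unit & f 0%N = psX ^+ m * e.
Proof.
case=> fm f0; exists (shift m (f 0%N)); last exact: shiftK.
by rewrite ps_unitE unitfE /shift.
Qed.

(** Since f (0, y) = y^m e with e a unit, the coefficient of x^i in q is forced: divide by e the
    part of order at least m in y of what the earlier coefficients leave over. *)
Lemma weierstrass_division m f g : regular m f ->
  exists q r, g = f * q + r /\ low_degree m r.
Proof.
move=> /regular_psX[e Ue Ef0].
have [|q Eq] := @ps_rec (ps C) 0 (fun i q =>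
   e^-1 * shift m (g i - \sum_(a < i) f a.+1 * q (i.-1 - a)%N)).
  move=> n u v Euv; congr (_ * shift m (_ - _)); apply: eq_bigr => a _.
  by rewrite Euv //; have := ltn_ord a; lia.
exists q, (g - f * q); split=> [|i b mb]; first by rewrite addrC subrK.
rewrite psB psB psM big_ord_recl subn0 Ef0 Eq mulrA mulrK //.
set h := \sum_(a < i) _; set h' := \sum_(a < i) _; have -> : h' = h.
  by apply: eq_bigr => a _; congr (_ * q _); rewrite /= /bump; lia.
by rewrite psD psXnM mb /shift subnK // psB subrK subrr.
Qed.

(** If n is the first index with [q n] nonzero, row n of f q is y^m e (q n): it is divisible by y^m
    and of degree < m, hence zero. *)
Lemma weierstrass_uniqueness m f q : regular m f -> low_degree m (f * q) -> q = 0.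
Proof.
move=> /regular_psX[e Ue Ef0] low; apply: contrapT => /ps_lead[n /eqP qn0 q0].
have [t qnt _] := ps_lead qn0.
have E : (f * q) n = psX ^+ m * (e * q n).
  by rewrite mulrA -Ef0 -[n in LHS]add0n (psM_lead _ q0).
have : e * q n = 0.
  apply/funext=> b; have := low n (b + m)%N (leq_addl _ _).
  by rewrite E psXnM leq_addl addnK.
by move/(congr1 ( *%R e^-1)); rewrite mulKr // mulr0.
Qed.

(** Weierstrass polynomials: monic of degree m in y, with the lower coefficients vanishing at x =
    0. *)
Definition weierstrass m W := low_degree m (W - vary ^+ m) /\ forall b, (b < m)%N -> W 0%N b = 0.

Lemma varyXE m i b : (vary ^+ m : S) i b = ((i == 0%N) && (b == m))%:R.
Proof.
rewrite -[vary ^+ m]mulr1 varyE ps1 psX_b subn_eq0.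
by case: ltngtP; rewrite ?andbF ?andbT.
Qed.

Lemma weierstrass0 m W : weierstrass m W -> W 0%N = psX ^+ m.
Proof.
case=> lowW W0; apply/funext=> b; have -> : (psX ^+ m : ps C) b = (b == m)%:R.
  by have := varyXE m 0 b; rewrite -rmorphXn.
have [/(lowW 0%N)|bm] := leqP m b; last by rewrite W0 // ltn_eqF.
by rewrite psB psB varyXE => /subr0_eq.
Qed.

Lemma regular_weierstrass m W : weierstrass m W -> regular m W.
Proof.
move=> wW; split; last by case: wW.
by rewrite (weierstrass0 wW) -[psX ^+ m]mulr1 psXnM leqnn subnn ps1 oner_eq0.
Qed.

(** Divide y^m by g. The quotient is the desired unit: comparing the coefficients of y^m at x = 0
    shows that its constant term is nonzero, and U g is y^m minus the remainder. *)
Lemma weierstrass_preparation m g : convergent g -> regular m g ->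
  exists U : S, [/\ convergent U, U \is a GRing.unit & weierstrass m (U * g)].
Proof.
move=> cg rg; have [q [r [E low]]] := weierstrass_division (vary ^+ m) rg.
have Er : r = vary ^+ m - g * q by rewrite E addrC addKr.
have g0q b : (b < m)%N -> (g * q) 0%N b = 0.
  move=> bm; rewrite psM0 psM big1 // => a _; rewrite rg.2 ?mul0r //.
  exact: leq_ltn_trans (leq_ord a) bm.
exists q; split.
- apply: (@convergent_quotient _ g (vary ^+ m) q m) => //; [exact: convergentX (convergent_vary R)|exact: rg.2|exact: rg.1|].
  by move=> i b; rewrite E psD psD (low _ _ (leq_addl _ _)) addr0.
- rewrite !ps_unitE unitfE; apply/eqP=> q00.
  have := congr1 (fun f : S => f 0%N m) E; rewrite varyXE !eqxx.
  rewrite psD psD low // addr0 psM0 -[m in X in _ = X]addn0 (psM_lead rg.2) //.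
  by rewrite q00 mulr0 => /eqP; rewrite oner_eq0.
split=> [i b mb|b bm]; last by rewrite mulrC g0q.
by rewrite mulrC -[g * q](subrK (vary ^+ m)) addrK -opprB -Er psN psN low ?oppr0.
Qed.
End Weierstrass.

(** * Strict transforms and their images *)

Section Branches.
Variable R : realType.
Local Notation C := (R[i]).
Local Notation S := (ps (ps C)).
Local Notation varx := (@varx R).
Local Notation vary := (@vary R).
Implicit Types (f g h W : S) (q : direction R).

Lemma smulE f g : smul f g = f * g.
Proof. by apply/funext=> i; apply/funext=> j; rewrite psM2. Qed.

Lemma unit00 f : (f \is a GRing.unit) = (f 0%N 0%N != 0).
Proof. by rewrite !ps_unitE unitfE. Qed.

Lemma branchP f : branch_equation f <->
  [/\ convergent f, f 0%N 0%N = 0 &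
      forall g h, convergent g -> convergent h -> f = g * h ->
        g \is a GRing.unit \/ h \is a GRing.unit].
Proof.
split=> -[cf f0 irr]; split=> // g h cg ch E; rewrite ?unit00.
  by case: (irr g h cg ch); rewrite ?smulE // /vanishing => /eqP; [left|right].
have := irr g h cg ch; rewrite -smulE !unit00 => /(_ E).
by case=> /eqP; [left|right].
Qed.

Lemma branch_neq0 f : branch_equation f -> f <> 0.
Proof.
move=> /branchP[_ _ irr] f0; have c0 := @convergent0 R.
by case: (irr 0 0 c0 c0); rewrite ?mulr0 // unitr0.
Qed.

Lemma varx_neq0 : varx != 0.
Proof.
have v1 : varx 1%N 0%N = 1 by [].
by apply/eqP=> v0; move/eqP: v1; rewrite v0 eq_sym oner_eq0.
Qed.

Lemma varx_pow_inj a b f g : varx ^+ a * f = varx ^+ b * g ->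
  f 0%N <> 0 -> g 0%N <> 0 -> a = b /\ f = g.
Proof.
wlog: a b f g / (a <= b)%N => [W E f0 g0|ab E f0 g0].
  have [ab|/ltnW ba] := leqP a b; first exact: W.
  by have [] := W _ _ _ _ ba (esym E) g0 f0.
have ab' : a = b.
  apply/eqP; rewrite eqn_leq ab /= leqNgt; apply/negP=> lab; apply: f0.
  have := congr1 (fun h : S => h a) E.
  by rewrite !psXnM leqnn subnn leqNgt lab.
split=> //; apply: (mulfI (expf_neq0 b varx_neq0)); by rewrite -{1}ab'.
Qed.

(** Local equation of the new exceptional curve at the direction q; [off_axis] expresses that f is
    not divisible by it. *)
Definition axis q : S := if q is Some _ then varx else vary.
Definition off_axis q f : Prop := if q is Some _ then f 0%N <> 0 else swap f 0%N <> 0.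

Lemma homog_swap f k j : (j <= k)%N -> (homog (swap f) k)`_j = (homog f k)`_(k - j).
Proof. by move=> jk; rewrite !coef_homog jk leq_subr subKn. Qed.

Definition multiplicity m f := homog f m <> 0 /\ forall k, (k < m)%N -> homog f k = 0.

Lemma multiplicityP f : f <> 0 -> exists m, multiplicity m f.
Proof.
move=> f0; have [|m /eqP fm fk] := @ps_lead {poly C} (homog f).
  by move=> /esym H; apply: f0; apply: homog_inj; rewrite -H rmorph0.
by exists m.
Qed.

Lemma homog_swap_eq0 f k : homog f k = 0 -> homog (swap f) k = 0.
Proof.
move=> E; apply/polyP=> j; rewrite coef0; have [jk|kj] := leqP j k.
  by rewrite homog_swap // E coef0.
by rewrite coef_homog leqNgt kj.
Qed.
Lemma multiplicity_swap m f : multiplicity m f -> multiplicity m (swap f).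
Proof.
by case=> fm fk; split=> [E|k /fk]; [apply: fm; rewrite -[f]swapK|]; exact: homog_swap_eq0.
Qed.

(** Value of the initial form of f at the direction q. It is the constant term of the strict
    transform there, so it vanishes exactly at the tangent directions. *)
Definition tangent q m f := if q is Some c then (homog f m).[c] else f 0%N m.

Lemma strict_transform q m f : convergent f -> multiplicity m f ->
  exists K : S, [/\ convergent K, pull q f = axis q ^+ m * K, off_axis q K &
                    K 0%N 0%N = tangent q m f].
Proof.
have some c g : convergent g -> multiplicity m g ->
    exists K : S, [/\ convergent K, pull (Some c) g = varx ^+ m * K, K 0%N <> 0 &
                    K 0%N 0%N = (homog g m).[c]].
  move=> cg [gm gk]; have E : pull (Some c) g = varx ^+ m * shift m (pull (Some c) g).
    by apply: shiftK => k /gk E; rewrite pull_some E rmorph0.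
  exists (shift m (pull (Some c) g)); split=> //.
  - by apply: (@convergent_shift _ m); rewrite -E; apply: convergent_pull.
  - rewrite /shift add0n pull_some => E0; apply: gm; apply: (@translate_inj _ c).
    by rewrite E0 rmorph0.
  - by rewrite /shift add0n pull_some translate0.
case: q => [c|] cf mf; first exact: some.
have [K [cK EK K0 K00]] := some 0 _ (convergent_swap cf) (multiplicity_swap mf).
exists (swap K); split=> //; first exact: convergent_swap.
  by rewrite pull_none EK rmorphM rmorphXn /= swap_varx.
by rewrite /swap K00 /= horner_coef0 homog_swap // subn0 coef_homog leqnn subnn.
Qed.

Definition xcoef (b : nat) W : S := fun i => psC (W i b).

(* x^m W (x, y / x - c), for W of degree at most m in y *)
Definition blowdown m c W : S :=
  \sum_(b < m.+1) xcoef b W * (vary - cst c * varx) ^+ b * varx ^+ (m - b).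

Lemma pull_xcoef c b W : pull (Some c) (xcoef b W) = xcoef b W.
Proof.
apply/funext=> k; rewrite pull_some.
have -> : homog (xcoef b W) k = (W k b)%:P.
  apply/polyP=> j; rewrite coef_homog coefC /xcoef /psC.
  by case: j => [|j]; rewrite ?subn0 ?if_same.
by apply/funext=> l; rewrite /translate comp_polyC coefC; case: l.
Qed.

Lemma weierstrass_sum m W : weierstrass m W ->
  W = \sum_(b < m.+1) xcoef b W * vary ^+ b.
Proof.
move=> [lowW _]; apply/funext=> i; apply/funext=> n; rewrite !ps_sum.
have E b : (xcoef b W * vary ^+ b) i n = if n == b then W i b else 0.
  rewrite mulrC varyE /xcoef; case: ltngtP => // [nb|->]; last by rewrite subnn.
  by rewrite -subn_gt0 in nb; case: subn nb.
under eq_bigr do rewrite E.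
have [nm|mn] := ltnP n m.+1.
  rewrite (bigD1 (Ordinal nm)) //= eqxx big1 ?addr0 // => b /eqP nb.
  by case: eqP => // E'; case: nb; apply: val_inj.
rewrite big1 => [|b _]; last by case: eqP => // E'; have := ltn_ord b; lia.
have := lowW i n (ltnW mn); rewrite psB psB varyXE => /subr0_eq ->.
by rewrite (gtn_eqF mn) andbF.
Qed.

(** y - c x pulls back to x y', and x^(m - b) completes the power of x in each term to x^m. *)
Lemma pull_blowdown m c W : weierstrass m W ->
  pull (Some c) (blowdown m c W) = varx ^+ m * W.
Proof.
move=> wW; rewrite [in RHS](weierstrass_sum wW) mulr_sumr rmorph_sum; apply: eq_bigr => b _.
have Ec : pull (Some c) (cst c) = cst c.
  have -> : cst c = xcoef 0 (cst c) by apply/funext=> -[|i] //; rewrite /xcoef rmorph0.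
  exact: pull_xcoef.
rewrite 2!rmorphM 2!rmorphXn rmorphB rmorphM /= Ec pull_xcoef pull_some_varx pull_some_vary.
have -> : varx * (vary + cst c) - cst c * varx = varx * vary by ring.
have -> : varx ^+ m = varx ^+ (m - b) * varx ^+ b by rewrite -exprD subnK // -ltnS.
by rewrite exprMn; ring.
Qed.

Lemma convergent_blowdown m c W : convergent W -> convergent (blowdown m c W).
Proof.
move=> cW; apply: convergent_sum => b.
apply: convergentM; last exact/convergentX/convergent_varx.
apply: convergentM; last first.
  apply: convergentX; apply: convergentB; first exact: convergent_vary.
  by apply: convergentM; [exact: convergent_cst|exact: convergent_varx].
have [K K0 WK] := (convergentP W).1 cW.
apply/convergentP; exists (K ^ b.+1)%N => [|i j]; first by rewrite expn_gt0 K0.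
apply: le_trans (_ : `|W i b| <= _).
  by rewrite /xcoef /psC; case: j; rewrite ?normr0.
by apply: le_trans (WK i b) _; rewrite ler_nat -expnM leq_pexp2l //; nia.
Qed.

Section Blowdown.
Variables (m : nat) (c : C) (W : S).
Hypothesis wW : weierstrass m W.
Let f1 := blowdown m c W.

(** The initial form is read off W (0, y) = y^m, so c is the only tangent direction of the image. *)
Lemma homog_blowdown : homog f1 m = ('X - c%:P) ^+ m.
Proof.
apply: (@translate_inj _ c); rewrite -pull_some pull_blowdown // psXnM leqnn subnn.
rewrite (weierstrass0 wW) rmorphXn /=; congr (_ ^+ m); apply/funext=> l.
rewrite /translate comp_polyB comp_polyX comp_polyC addrK coefX; by case: l => [|[]].
Qed.

Lemma homog_blowdown_lt k : (k < m)%N -> homog f1 k = 0.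
Proof.
move=> km; apply: (@translate_inj _ c); rewrite -pull_some pull_blowdown // psXnM.
by rewrite leqNgt km rmorph0.
Qed.

Lemma multiplicity_blowdown : multiplicity m f1.
Proof.
split; last exact: homog_blowdown_lt.
by rewrite homog_blowdown; apply/eqP; rewrite expf_neq0 // polyXsubC_eq0.
Qed.

Lemma coef_blowdown_lt i j : (i + j < m)%N -> f1 i j = 0.
Proof.
move/homog_blowdown_lt=> /(congr1 (fun p : {poly C} => p`_j)).
by rewrite coef0 coef_homog leq_addl addnK.
Qed.

Lemma blowdown0 : f1 0%N m = 1.
Proof.
have := congr1 (fun p : {poly C} => p`_m) homog_blowdown.
rewrite coef_homog leqnn subnn => ->.
have /monicP := monic_exp m (monicXsubC c).
by rewrite lead_coefE size_exp_XsubC.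
Qed.

Lemma regular_blowdown : regular m f1.
Proof. by split=> [|b bm]; [rewrite blowdown0 oner_eq0|rewrite coef_blowdown_lt]. Qed.

(* Divide f = f1 Q + r: upstairs r is a multiple of W of degree < m in y, hence zero. *)
Lemma blowdown_dvd f M h : convergent W -> convergent f ->
  pull (Some c) f = varx ^+ M * (W * h) -> exists2 Q : S, convergent Q & f = f1 * Q.
Proof.
move=> cW cf E; have [Q [r [Ef low]]] := weierstrass_division f regular_blowdown.
exists Q.
  apply: (@convergent_quotient _ f1 f Q m) => //; [exact: convergent_blowdown|..].
  - exact: regular_blowdown.2.
  - exact: regular_blowdown.1.
  - by move=> i b; rewrite Ef psD psD (low _ _ (leq_addl _ _)) addr0.
have Er : pull (Some c) r = W * (varx ^+ M * h - varx ^+ m * pull (Some c) Q).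
  have := congr1 (pull (Some c)) Ef; rewrite E rmorphD rmorphM /= pull_blowdown // => H.
  by rewrite mulrBr (mulrCA W) H; ring.
(* Each homogeneous part of r has degree < m in y, and translation by c preserves the degree. *)
have lowr : low_degree m (pull (Some c) r).
  move=> i b mb; rewrite pull_some /translate nth_default //.
  apply: leq_trans mb; rewrite size_comp_poly2 ?size_XaddC //.
  apply/leq_sizeP => j mj; rewrite coef_homog; case: ifP => // _; exact: low.
move: (lowr); rewrite Er => /(weierstrass_uniqueness (regular_weierstrass wW)) H0.
suff r0 : r = 0 by rewrite Ef r0 addr0.
by apply: (@pull_some_inj _ c); rewrite Er H0 mulr0 rmorph0.
Qed.
End Blowdown.
End Branches.

Section StrictTransforms.
Variable R : realType.
Local Notation C := (R[i]).
Local Notation S := (ps (ps C)).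
Local Notation varx := (@varx R).
Local Notation vary := (@vary R).
Implicit Types (f g h W : S) (q : direction R).

Lemma branch_swap f : branch_equation f -> branch_equation (swap f).
Proof.
move=> /branchP[cf f0 irr]; apply/branchP; split=> // [|g h cg ch E]; first exact: convergent_swap.
have := irr (swap g) (swap h) (convergent_swap cg) (convergent_swap ch).
by rewrite -rmorphM -E !unit00 => /(_ erefl).
Qed.

(* If g = g1 g2, pushing g1 forward yields a factor of f. *)
Lemma branch_strict_some c f M g : branch_equation f ->
  pull (Some c) f = varx ^+ M * g -> convergent g -> g 0%N <> 0 -> g 0%N 0%N = 0 ->
  branch_equation g /\ (g 0%N 1%N <> 0 -> f 0%N 1%N <> 0 /\ f 1%N 0%N = - c * f 0%N 1%N).
Proof.
move=> /branchP[cf f0 irr] E cg g0 g00.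
(* A non-unit factor g1 of g is, up to a unit, a Weierstrass polynomial whose image divides f. The
   cofactor Q is a unit as f is irreducible, and cancelling the powers of x shows that g1 and g are
   associated. *)
have main g1 g2 : convergent g1 -> g1 0%N 0%N = 0 -> g = g1 * g2 ->
    exists m U Q, [/\ regular m g1, (U : S) \is a GRing.unit, weierstrass m (U * g1),
      (Q : S) 0%N 0%N != 0 & f = blowdown m c (U * g1) * Q /\ g = U * g1 * pull (Some c) Q].
  move=> cg1 g10 Eg.
  have g1n : g1 0%N <> 0 by move=> e; apply: g0; rewrite Eg psM0 e mul0r.
  have [m rg1] := regularP g1n; have [U [cU UU wW]] := weierstrass_preparation cg1 rg1.
  have cW := convergentM cU cg1.
  have EW : pull (Some c) f = varx ^+ M * (U * g1 * (U^-1 * g2)).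
    by rewrite E Eg; congr (_ * _); rewrite mulrACA divrr // mul1r.
  have [Q cQ EQ] := blowdown_dvd wW cW cf EW.
  have m0 : (0 < m)%N by rewrite lt0n; apply/eqP=> m0; case: rg1; rewrite m0 g10 eqxx.
  have Q0 : Q \is a GRing.unit.
    case: (irr (blowdown m c (U * g1)) Q (convergent_blowdown m c cW) cQ EQ) => [Ub|UQ]; last exact: UQ.
    move: Ub.
    rewrite unit00.
    rewrite (coef_blowdown_lt c wW) //.
    by rewrite eqxx.
  have Q00 : Q 0%N 0%N != 0 by rewrite -unit00.
  exists m, U, Q; split=> //.
  have : varx ^+ M * g = varx ^+ m * (U * g1 * pull (Some c) Q).
    by rewrite -E EQ rmorphM /= pull_blowdown // -[LHS]mulrA.
  case/varx_pow_inj => //; rewrite psM0 => /eqP; rewrite mulf_eq0.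
  rewrite (weierstrass0 wW) => /orP[|/eqP e].
    by move=> /eqP e; have := (regular_weierstrass wW).1; rewrite (weierstrass0 wW) e ps0 eqxx.
  by move/eqP: Q00; case; rewrite -(pull00 (Some c)) e.
split.
  apply/branchP; split=> // g1 g2 cg1 cg2 Eg.
  have [|g10] := boolP (g1 \is a GRing.unit); [by left|right].
  have [|m [U [Q [rg1 UU _ Q00 [_ Eg']]]]] := main g1 g2 cg1 _ Eg.
    by move: g10; rewrite unit00 negbK => /eqP.
  have g1n : g1 != 0 by apply/eqP=> e; case: rg1; rewrite e ps0 eqxx.
  have /(mulfI g1n) -> : g1 * g2 = g1 * (U * pull (Some c) Q).
    by rewrite -Eg Eg' mulrA (mulrC g1).
  by rewrite unitrM UU unit00 pull00.
move=> g01.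
(* From the factorization g = g * 1, f is a unit times an image under [blowdown]. Transversality
   forces m = 1, and the linear part of that image is y - c x. *)
have [|m [U [Q [rg UU wW Q00 [Ef _]]]]] := main g 1 cg g00; first by rewrite mulr1.
have m1 : m = 1%N.
  case: m rg {wW Ef} => [|[|m]] [] //; first by rewrite g00 eqxx.
  by move=> _ /(_ 1%N isT).
rewrite m1 in wW Ef; have hb := homog_blowdown c wW.
have b01 := blowdown0 c wW; have b00 : blowdown 1 c (U * g) 0%N 0%N = 0 by rewrite coef_blowdown_lt.
have b10 : blowdown 1 c (U * g) 1%N 0%N = - c.
  have := congr1 (fun p : {poly C} => p`_0) hb.
  by rewrite coef_homog expr1 coefB coefX coefC sub0r.
rewrite Ef !psM2 !(big_ord_recl, big_ord0) /= b00 b01 b10 !mul0r !add0r !addr0 !mul1r.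
by split=> //; apply/eqP.
Qed.

(** Smoothness at the origin with tangent direction q. *)
Definition smooth_along q f : Prop :=
  if q is Some c then f 0%N 1%N <> 0 /\ f 1%N 0%N = - c * f 0%N 1%N
  else f 1%N 0%N <> 0 /\ f 0%N 1%N = 0.

Definition transversal q g : Prop := if q is Some _ then g 0%N 1%N <> 0 else g 1%N 0%N <> 0.

Lemma branch_strict q f M g : branch_equation f ->
  pull q f = axis q ^+ M * g -> convergent g -> off_axis q g -> g 0%N 0%N = 0 ->
  branch_equation g /\ (transversal q g -> smooth_along q f).
Proof.
case: q => [c|] bf E cg g0 g00; first exact: branch_strict_some E _ _ _.
have Es : pull (Some 0) (swap f) = varx ^+ M * swap g.
  by rewrite -[LHS]swapK -pull_none E rmorphM rmorphXn /= swap_vary.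
have [/branch_swap bg H] := branch_strict_some (branch_swap bf) Es (convergent_swap cg) g0 g00.
by split=> // /H; rewrite /swap oppr0 mul0r.
Qed.

(** In a factorization of the image into non-units A and B, the initial forms multiply to a power of
    z - c, so both vanish at c. Both strict transforms then pass through the point c, and their
    product is associated to g, against irreducibility. *)
Lemma blowdown_branch m c g W (U : S) : branch_equation g -> convergent U -> U \is a GRing.unit -> W = U * g ->
  convergent W -> weierstrass m W -> (0 < m)%N -> branch_equation (blowdown m c W).
Proof.
move=> /branchP[cg g0 irr] cU UU EW cW wW m0; have cf := convergent_blowdown m c cW.
apply/branchP; split=> // [|A B cA cB EAB]; first by rewrite coef_blowdown_lt.
have [fm fk] := multiplicity_blowdown c wW.
have f1n : blowdown m c W <> 0 by move=> e; apply: fm; rewrite e rmorph0.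
have An : A <> 0 by move=> e; apply: f1n; rewrite EAB e mul0r.
have Bn : B <> 0 by move=> e; apply: f1n; rewrite EAB e mulr0.
have [a mA] := multiplicityP An; have [b mB] := multiplicityP Bn.
have Eab : homog (blowdown m c W) (a + b)%N = homog A a * homog B b.
  by rewrite EAB rmorphM; apply: psM_lead; [exact: mA.2|exact: mB.2].
have abm : (a + b)%N = m.
  apply/eqP; rewrite eqn_leq; apply/andP; split; rewrite leqNgt; apply/negP=> lt.
    apply: fm; rewrite EAB rmorphM /= psM big1 // => i _.
    have [ia|ai] := ltnP i a; first by rewrite mA.2 ?mul0r.
    by rewrite mB.2 ?mulr0 //; have := ltn_ord i; lia.
  by have /eqP := fk _ lt; rewrite Eab mulf_eq0 => /orP[] /eqP e; [case: mA|case: mB].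
rewrite abm homog_blowdown // in Eab.
(* The degrees add up to m, so P has degree exactly k > 0; it has a root, and c is the only possible
   one. *)
have root_of (P Q : {poly C}) k : (size P <= k.+1)%N -> (size Q <= (m - k).+1)%N ->
   ('X - c%:P) ^+ m = P * Q -> (0 < k <= m)%N -> P.[c] = 0.
  move=> sP sQ EPQ /andP[k0 km]; apply/eqP/contraT => Pc.
  have PQ0 : P * Q != 0 by rewrite -EPQ expf_neq0 // polyXsubC_eq0.
  move: (PQ0); rewrite mulf_eq0 negb_or => /andP[P0 Q0].
  have sPQ : size (P * Q) = m.+1 by rewrite -EPQ size_exp_XsubC.
  have /closed_rootP[z /rootP Pz] : size P != 1%N.
    move: sP sQ sPQ; rewrite size_mul //; move: (size P) (size Q) => s t.
    by case: eqP => // ->; lia.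
  have : (('X - c%:P) ^+ m).[z] = 0 by rewrite EPQ hornerM Pz mul0r.
  rewrite horner_exp hornerXsubC => /eqP; rewrite expf_eq0 subr_eq0 => /andP[_ /eqP zc].
  by move: Pc; rewrite -zc Pz eqxx.
have mult00 (D : S) k : multiplicity k D -> (0 < k)%N \/ D \is a GRing.unit.
  case: k => [|k] [Dk _]; [right|by left].
  rewrite unit00; apply/eqP=> D0; apply: Dk; apply/polyP=> j.
  by rewrite coef_homog coef0; case: j.
have [a0|] := mult00 A a mA; last by left.
have [b0|] := mult00 B b mB; last by right.
exfalso.
have [KA [cKA EKA A0 KA0]] := strict_transform (Some c) cA mA.
have [KB [cKB EKB B0 KB0]] := strict_transform (Some c) cB mB.
have : varx ^+ m * W = varx ^+ m * (KA * KB).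
  by rewrite -(pull_blowdown c wW) EAB rmorphM /= EKA EKB -abm exprD mulrACA.
move/(mulfI (expf_neq0 m (varx_neq0 R))); rewrite EW => EK.
have cUK : convergent (U^-1 * KA) by apply: convergentM => //; apply: convergentV.
have Eg : g = U^-1 * KA * KB by rewrite -mulrA -EK mulKr.
case: (irr _ _ cUK cKB Eg).
- rewrite unitrM unit00 => /andP[_]; rewrite unit00 KA0 /= (root_of _ _ a _ _ Eab) ?eqxx //.
  + exact: size_homog.
  + by rewrite -abm addKn; exact: size_homog.
  + by rewrite a0 -abm leq_addr.
- rewrite unit00 KB0 /= (root_of _ (homog A a) b) ?eqxx //.
  + exact: size_homog.
  + by rewrite -abm addnK; exact: size_homog.
  + by rewrite mulrC.
  + by rewrite b0 -abm leq_addl.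
Qed.
End StrictTransforms.

(** * Normal crossings *)

Section NormalCrossings.
Variable R : realType.
Local Notation C := (R[i]).
Local Notation S := (ps (ps C)).
Local Notation varx := (@varx R).
Local Notation vary := (@vary R).
Implicit Types (f g h u v w F K U W : S) (q : direction R).

Definition cunit U : Prop := convergent U /\ U \is a GRing.unit.

Lemma cunit1 : cunit 1. Proof. by split; [exact: convergent1|exact: unitr1]. Qed.
Lemma cunitM U W : cunit U -> cunit W -> cunit (U * W).
Proof. by move=> [cU UU] [cW UW]; split; [exact: convergentM|rewrite unitrM UU]. Qed.
Lemma cunitX U n : cunit U -> cunit (U ^+ n).
Proof. by move=> [cU UU]; split; [exact: convergentX|exact: unitrX]. Qed.
Lemma cunitV U : cunit U -> cunit U^-1.
Proof. by move=> [cU UU]; split; [exact: convergentV|rewrite unitrV]. Qed.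
Lemma cunit_pull q U : cunit U -> cunit (pull q U).
Proof. by move=> [cU UU]; split; [exact: convergent_pull|rewrite unit00 pull00 -unit00]. Qed.
Lemma cunit_swap U : cunit U -> cunit (swap U).
Proof. by move=> [cU UU]; split; [exact: convergent_swap|move: UU; rewrite !unit00]. Qed.

Lemma normal_crossingP F : normal_crossing F <->
  exists u v w a b, [/\ local_coordinates u v, cunit w & F = w * (u ^+ a * v ^+ b)].
Proof.
have sexpE (f : S) n : sexp f n = f ^+ n.
  by elim: n => [|n IH]; [apply/funext=> -[|i]; apply/funext=> -[|j]|rewrite exprS -IH -smulE].
split=> -[u [v [w [a [b [luv]]]]]].
  move=> cw w0; rewrite !sexpE !smulE => ->; exists u, v, w, a, b; split=> //.
  by split=> //; rewrite unit00; apply/eqP.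
case=> cw; rewrite unit00 => /eqP w0 ->; exists u, v, w, a, b.
by rewrite !sexpE !smulE.
Qed.

Lemma local_coordinatesC u v : local_coordinates u v -> local_coordinates v u.
Proof.
move=> [cu cv u0 v0 d]; split=> //; rewrite -oppr_eq0 opprB; congr (_ != 0): d; ring.
Qed.
Lemma local_coordinates_swap u v : local_coordinates u v -> local_coordinates (swap u) (swap v).
Proof.
move=> [cu cv u0 v0 d]; split; rewrite /swap //; [exact: convergent_swap|exact: convergent_swap|].
by rewrite -oppr_eq0 opprB; congr (_ != 0): d; ring.
Qed.
Lemma normal_crossing_swap F : normal_crossing F -> normal_crossing (swap F).
Proof.
move=> /normal_crossingP[u [v [w [a [b [luv cw ->]]]]]]; apply/normal_crossingP.
exists (swap u), (swap v), (swap w), a, b; split; first exact: local_coordinates_swap.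
  exact: cunit_swap.
by rewrite !rmorphM !rmorphXn.
Qed.

Lemma varx_coef i j : varx i j = ((i == 1%N) && (j == 0%N))%:R.
Proof. exact: psX_b. Qed.
Lemma vary_coef i j : vary i j = ((i == 0%N) && (j == 1%N))%:R.
Proof. by rewrite -swap_varx /swap varx_coef andbC. Qed.

Lemma local_coordinates_x g : convergent g -> g 0%N 0%N = 0 -> g 0%N 1%N <> 0 ->
  local_coordinates varx g.
Proof.
move=> cg g0 g1; split=> //; first exact: convergent_varx.
by rewrite !varx_coef /= mul0r subr0 mul1r; apply/eqP.
Qed.

Lemma local_coordinates_xy : local_coordinates varx vary.
Proof.
apply: local_coordinates_x; [exact: convergent_vary|by rewrite vary_coef|rewrite vary_coef /=].
by apply/eqP; rewrite oner_eq0.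
Qed.

Lemma normal_crossing_axes w a b K : cunit w -> cunit K ->
  normal_crossing (w * (varx ^+ a * (vary ^+ b * K))).
Proof.
move=> Uw UK; apply/normal_crossingP; exists varx, vary, (w * K), a, b.
split; [exact: local_coordinates_xy|exact: cunitM|ring].
Qed.

Lemma normal_crossing_x w a g : cunit w -> convergent g -> g 0%N 0%N = 0 -> g 0%N 1%N <> 0 ->
  normal_crossing (w * (varx ^+ a * g)).
Proof.
move=> Uw cg g0 g1; apply/normal_crossingP; exists varx, g, w, a, 1%N.
by split=> //; exact: local_coordinates_x.
Qed.

Lemma psX_neq0 (A : comNzRingType) : (psX : ps A) <> 0.
Proof. by move=> e; have /eqP := congr1 (fun f : ps A => f 1%N) e; rewrite oner_eq0. Qed.

(** Setting x = 0 shows that one of the coordinates u, v is divisible by x; its linear part being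
    nonzero, it is x times a unit. Cancelling x leaves a power of the other coordinate. *)
Lemma normal_crossing_x_inv w a K : cunit w -> (0 < a)%N -> K 0%N <> 0 ->
  normal_crossing (w * (varx ^+ a * K)) ->
  exists U v k, [/\ cunit U, K = U * v ^+ k, convergent v, v 0%N 0%N = 0 & v 0%N 1%N <> 0].
Proof.
move=> Uw a0 K0 /normal_crossingP[u [v [w' [p [k [luv Uw' E]]]]]].
have nz0 (U : S) : cunit U -> U 0%N <> 0.
  by case=> _; rewrite unit00 => /eqP UU e; apply: UU; rewrite e.
have uv0 : u 0%N = 0 \/ v 0%N = 0.
  have := congr1 (fun f : S => f 0%N) E; rewrite mulrCA psXnM leqNgt a0 /= => /esym/eqP.
  rewrite psM0 mulf_eq0 => /orP[/eqP/(nz0 _ Uw')//|].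
  have X0 (f : S) n : (f ^+ n) 0%N = f 0%N ^+ n.
    by elim: n => [|n IH]; rewrite ?expr0 // !exprS psM0 IH.
  by rewrite psM0 mulf_eq0 !X0 !expf_eq0 => /orP[/andP[_ /eqP]|/andP[_ /eqP]]; [left|right].
wlog u0 : u v p k luv E {uv0} / u 0%N = 0.
  move=> W; case: uv0 => [|v0]; first exact: (W u v p k).
  by apply: (W v u k p) => //; [exact: local_coordinatesC|rewrite (mulrC (v ^+ k))].
case: luv => cu cv _ v00; have u01 : u 0%N 1%N = 0 by rewrite u0.
rewrite u01 mul0r subr0 mulf_eq0 negb_or => /andP[u10 /eqP v01].
have Eu : u = varx ^+ 1 * shift 1 u by apply: shiftK => -[].
have U1 : cunit (shift 1 u).
  by split; [apply: (@convergent_shift _ 1); rewrite -Eu|rewrite unit00].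
set u1 := shift 1 u in Eu U1.
have E' : varx ^+ a * (w * K) = varx ^+ p * (w' * u1 ^+ p * v ^+ k).
  have -> : varx ^+ a * (w * K) = w * (varx ^+ a * K) by ring.
  by rewrite E {1}Eu expr1 exprMn; ring.
have vk0 : (v ^+ k) 0%N <> 0.
  have vn : v 0%N != 0 by apply/eqP=> e; apply: v01; rewrite e.
  have -> : (v ^+ k) 0%N = v 0%N ^+ k.
    by elim: (k) => [|n IH]; rewrite ?expr0 // !exprS psM0 IH.
  by apply/eqP; rewrite expf_neq0.
have wK0 : (w * K) 0%N <> 0.
  by rewrite psM0 => /eqP; rewrite mulf_eq0 => /orP[] /eqP; [exact: nz0|exact: K0].
have r0 : (w' * u1 ^+ p * v ^+ k) 0%N <> 0.
  rewrite psM0 => /eqP; rewrite mulf_eq0 => /orP[] /eqP; last exact: vk0.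
  by apply: nz0; apply: cunitM => //; exact: cunitX.
have [_ EwK] := varx_pow_inj E' wK0 r0.
exists (w^-1 * (w' * u1 ^+ p)), v, k; split=> //.
  by apply: cunitM; [exact: cunitV|apply: cunitM => //; exact: cunitX].
by rewrite -mulrA -EwK mulKr //; case: Uw.
Qed.

(** In K = U v^k, the exponent 0 would make K a unit and an exponent above 1 would make it
    reducible. *)
Lemma normal_crossing_x_branch w a K : cunit w -> (0 < a)%N -> branch_equation K -> K 0%N <> 0 ->
  normal_crossing (w * (varx ^+ a * K)) -> K 0%N 1%N <> 0.
Proof.
move=> Uw a0 /branchP[cK K00 irr] K0 /(normal_crossing_x_inv Uw a0 K0).
move=> [U [v [[|[|k]] [[cU UU] EK cv v00 v01]]]].
- by move: UU; rewrite unit00 -[U]mulr1 -[1](expr0 v) -EK K00 eqxx.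
- rewrite EK expr1 psM2 !(big_ord_recl, big_ord0) /= v00 mulr0 !addr0 => /eqP.
  by rewrite mulf_eq0 -[U 0%N 0%N == 0]negbK -unit00 UU => /eqP.
have cUv : convergent (U * v ^+ k.+1) by apply: convergentM => //; exact: convergentX.
have EK' : K = v * (U * v ^+ k.+1) by rewrite EK [v ^+ k.+2]exprS; exact: mulrCA.
case: (irr _ _ cv cUv EK'); rewrite unit00 ?v00 ?eqxx //.
by rewrite exprS mulrCA !psM0 v00 mul0r eqxx.
Qed.

(** The axes x = 0 and y = 0 use up both local coordinates, which leaves only a unit for g. *)
Lemma normal_crossing_xy_inv w a b g : cunit w -> (0 < a)%N -> (0 < b)%N ->
  g 0%N <> 0 -> swap g 0%N <> 0 ->
  normal_crossing (w * (varx ^+ a * (vary ^+ b * g))) -> g 0%N 0%N <> 0.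
Proof.
move=> Uw a0 b0 g0 sg0 nc.
have yg0 : (vary ^+ b * g) 0%N <> 0.
  rewrite psM0 -rmorphXn /= => /eqP; rewrite mulf_eq0 => /orP[] /eqP //.
  by apply/eqP; rewrite expf_neq0 //; apply/eqP; exact: psX_neq0.
have [U [v [k [UU E cv v00 v01]]]] := normal_crossing_x_inv Uw a0 yg0 nc.
have Es : varx ^+ b * swap g = swap U * swap v ^+ k.
  by have := congr1 (@swap C) E; rewrite !rmorphM !rmorphXn /= swap_vary.
have [cU' UU'] := cunit_swap UU.
have U0 : swap U 0%N <> 0 by move: UU'; rewrite unit00 => /eqP UU' e; apply: UU'; rewrite e.
have v0 : swap v 0%N = 0.
  have := congr1 (fun f : S => f 0%N) Es; rewrite psXnM leqNgt b0 /= psM0 => /esym/eqP.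
  rewrite mulf_eq0 => /orP[/eqP//|].
  have -> : (swap v ^+ k) 0%N = swap v 0%N ^+ k.
    by elim: (k) => [|n IH]; rewrite ?expr0 // !exprS psM0 IH.
  by rewrite expf_eq0 => /andP[_ /eqP].
have Ev : swap v = varx ^+ 1 * shift 1 (swap v) by apply: shiftK => -[].
have Uv : shift 1 (swap v) \is a GRing.unit by rewrite unit00; apply/eqP.
rewrite Ev expr1 exprMn mulrCA in Es.
have UU2 : swap U * shift 1 (swap v) ^+ k \is a GRing.unit by rewrite unitrM UU' unitrX.
have [//||_ Eg] := varx_pow_inj Es.
  by move: UU2; rewrite unit00 => /eqP H e; apply: H; rewrite e.
by have := UU2; rewrite -Eg unit00 => /eqP.
Qed.

(** A coordinate pulls back to x times a germ whose constant term is its linear part at (1, c). By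
    independence at most one of these constants vanishes, and the germ concerned is then transversal
    to x = 0. *)
Lemma normal_crossing_pull q F : normal_crossing F -> normal_crossing (pull q F).
Proof.
have some (c : C) (G : S) : normal_crossing G -> normal_crossing (pull (Some c) G).
  move=> /normal_crossingP[u [v [w [a [b [luv Uw ->]]]]]].
  have lin (f : S) : convergent f -> f 0%N 0%N = 0 -> exists f' : S,
      [/\ convergent f', pull (Some c) f = varx * f',
        f' 0%N 0%N = f 1%N 0%N + f 0%N 1%N * c & f' 0%N 1%N = f 0%N 1%N].
    move=> cf f0; exists (shift 1 (pull (Some c) f)).
    have E : pull (Some c) f = varx ^+ 1 * shift 1 (pull (Some c) f).
      apply: shiftK => -[|//] _; rewrite pull_some.
      have -> : homog f 0%N = 0; last exact: rmorph0.
      by apply/polyP=> j; rewrite coef_homog coef0; case: j.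
    split=> //; first by apply: (@convergent_shift _ 1); rewrite -E; exact: convergent_pull.
      by rewrite /shift /pull /= !big_ord_recl big_ord0 /= expr0 mulr1 addr0.
    by rewrite /shift /pull /= !big_ord_recl big_ord0 /= bin0n mulr0n add0r addr0 expr0 mulr1.
  case: (luv) => cu cv u0 v0 d.
  have [u' [cu' Eu u'0 u'1]] := lin u cu u0; have [v' [cv' Ev v'0 v'1]] := lin v cv v0.
  rewrite !(rmorphM, rmorphXn) /= Eu Ev.
  have Upw := cunit_pull (Some c) Uw.
  have half f g (k l : nat) : convergent f -> f 0%N 0%N = 0 -> f 0%N 1%N <> 0 -> cunit g ->
      normal_crossing (pull (Some c) w * ((varx * f) ^+ k * (varx * g) ^+ l)).
    move=> cf f0 f1 Ug; apply/normal_crossingP; exists varx, f, (pull (Some c) w * g ^+ l), (k + l)%N, k.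
    split; [exact: local_coordinates_x|by apply: cunitM => //; exact: cunitX|].
    by rewrite !exprMn exprD; ring.
  have [eu|nu] := eqVneq (u' 0%N 0%N) 0; have [ev|nv] := eqVneq (v' 0%N 0%N) 0.
  - case/negP: d; rewrite u'0 in eu; rewrite v'0 in ev.
    have -> : u 1%N 0%N = - (u 0%N 1%N * c) by apply/eqP; rewrite -addr_eq0 eu.
    have -> : v 1%N 0%N = - (v 0%N 1%N * c) by apply/eqP; rewrite -addr_eq0 ev.
    by apply/eqP; ring.
  - apply: half => //; last by split=> //; rewrite unit00.
    rewrite u'1 => u1; case/negP: d; move: eu; rewrite u'0 u1 mul0r addr0 => ->.
    by rewrite !mul0r subrr.
  - rewrite (mulrC ((varx * u') ^+ a)); apply: half => //; last by split=> //; rewrite unit00.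
    rewrite v'1 => v1; case/negP: d; move: ev; rewrite v'0 v1 mul0r addr0 => ->.
    by rewrite !mulr0 subrr.
  have Uu' : cunit u' by split=> //; rewrite unit00.
  have Uv' : cunit v' by split=> //; rewrite unit00.
  apply/normal_crossingP; exists varx, vary, (pull (Some c) w * (u' ^+ a * v' ^+ b)), (a + b)%N, 0%N.
  split; [exact: local_coordinates_xy|by apply: cunitM => //; apply: cunitM; exact: cunitX|].
  by rewrite !exprMn exprD expr0; ring.
case: q => [c|] nc; first exact: some.
by rewrite pull_none; apply: normal_crossing_swap; apply: some; exact: normal_crossing_swap.
Qed.
End NormalCrossings.

(** * Resolution of a branch *)

Section Resolution.
Variable R : realType.
Local Notation C := (R[i]).
Local Notation S := (ps (ps C)).
Local Notation varx := (@varx R).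
Local Notation vary := (@vary R).
Implicit Types (f g h u v w F K U W : S) (q : direction R) (d : seq (direction R)) (ax : axes).

Lemma multiplicity_gt0 m f : multiplicity m f -> f 0%N 0%N = 0 -> (0 < m)%N.
Proof.
case: m => // -[f0 _] f00; case: f0; apply/polyP=> j.
by rewrite coef_homog coef0; case: j.
Qed.

Lemma swap0_neq0 U g : cunit U -> swap g 0%N <> 0 -> swap (U * g) 0%N <> 0.
Proof.
move=> /cunit_swap[_ UU] g0; rewrite rmorphM psM0 => /eqP; rewrite mulf_eq0.
move=> /orP[/eqP U0|/eqP//]; by move: UU; rewrite unit00 U0 eqxx.
Qed.

Lemma blow_down_some c g : branch_equation g -> g 0%N <> 0 -> swap g 0%N <> 0 ->
  exists f m U, [/\ branch_equation f, multiplicity m f, cunit U,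
     pull (Some c) f = varx ^+ m * (U * g) & homog f m = ('X - c%:P) ^+ m]
   /\ [/\ f 0%N <> 0, swap f 0%N <> 0 & f 0%N m = 1].
Proof.
move=> bg g0 sg0; have /branchP[cg g00 _] := bg.
have [m rg] := regularP g0; have [U [cU UU wW]] := weierstrass_preparation cg rg.
have cW := convergentM cU cg.
have m0 : (0 < m)%N by rewrite lt0n; apply/eqP=> m0; case: rg; rewrite m0 g00 eqxx.
have b1 := blowdown0 c wW; have hm := homog_blowdown c wW.
have E := pull_blowdown c wW.
exists (blowdown m c (U * g)), m, U; split; split=> //.
- exact: (blowdown_branch c bg cU UU erefl cW wW m0).
- exact: multiplicity_blowdown.
- by move=> e; move/eqP: b1; rewrite e eq_sym oner_eq0.
move=> e; have e' k : blowdown m c (U * g) k 0%N = 0 by apply: (congr1 (@^~ k) e).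
(* The image f is not divisible by y: for c = 0, U g would be too; for c <> 0, its initial form
   contains the monomial x^m. *)
have [c0|c0] := eqVneq c 0.
  apply: (@swap0_neq0 U g) => //; apply/funext=> k.
  have := congr1 (fun h : S => h (m + k)%N 0%N) E.
  rewrite varxE leq_addr addKn pull_some translate0 c0 horner_coef0 coef_homog subn0 -c0 e'.
  by rewrite /swap => <-.
have := congr1 (fun p : {poly C} => p.[0]) hm; rewrite horner_exp hornerXsubC sub0r.
rewrite horner_coef0 coef_homog subn0 e' => /esym/eqP.
by rewrite expf_eq0 oppr_eq0 (negPf c0) andbF.
Qed.

Lemma blow_down q g : branch_equation g -> g 0%N <> 0 -> swap g 0%N <> 0 ->
  exists f m U, [/\ branch_equation f, multiplicity m f, cunit U &
     pull q f = axis q ^+ m * (U * g)]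
   /\ [/\ f 0%N <> 0, swap f 0%N <> 0 & forall q', q' <> q -> tangent q' m f <> 0].
Proof.
case: q => [c|] bg g0 sg0.
  have [f [m [U [[bf mf UU E hm] [f0 sf0 f1]]]]] := blow_down_some c bg g0 sg0.
  exists f, m, U; split; split=> // -[c'|] /= nc; last by rewrite f1; apply/eqP; rewrite oner_eq0.
  rewrite hm horner_exp hornerXsubC; apply/eqP; rewrite expf_neq0 // subr_eq0.
  by apply/eqP=> e; apply: nc; rewrite e.
have [f [m [U [[bf mf UU E hm] [f0 sf0 f1]]]]] := blow_down_some 0 (branch_swap bg) sg0 g0.
exists (swap f), m, (swap U); split; split=> //.
- exact: branch_swap.
- exact: multiplicity_swap.
- exact: cunit_swap.
- by rewrite pull_none swapK E !rmorphM rmorphXn /= swap_varx.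
case=> [c'|] // _; rewrite /tangent.
have -> : homog (swap f) m = 1; last by rewrite hornerC; apply/eqP; rewrite oner_eq0.
apply/polyP=> j; rewrite coef1; have [jm|mj] := leqP j m.
  rewrite homog_swap // hm subr0 coefXn; congr (_%:R).
  by have /branchP[_ f00 _] := bf; have m0 := multiplicity_gt0 mf f00; lia.
by rewrite coef_homog leqNgt mj; case: j mj.
Qed.

Definition axes_times w a b g : S := w * (varx ^+ a * (vary ^+ b * g)).

(** Multiplicities of the axes in the total transform after a blow-up: the new curve gets a + b + m,
    where m is the multiplicity of the strict transform. *)
Definition exponents q m a b : nat * nat :=
  if q is Some c then ((a + b + m)%N, if c == 0 then b else 0%N) else (a, (a + b + m)%N).

(** An axis divides the exceptional part of the total transform iff it is recorded as
    exceptional. *)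
Definition compatible ax a b : Prop := (0 < a)%N = isSome ax.1 /\ (0 < b)%N = isSome ax.2.

Lemma compatible_step i ax q m a b : (0 < m)%N -> compatible ax a b ->
  compatible (axes_step i ax q) (exponents q m a b).1 (exponents q m a b).2.
Proof.
move=> m0 [ea eb]; case: q => [c|]; split=> //=; rewrite ?addn_gt0 ?m0 ?orbT //.
by case: ifP.
Qed.

Lemma pull_total q w a b g m K : cunit w -> pull q g = axis q ^+ m * K ->
  exists2 w', cunit w' &
    pull q (axes_times w a b g) = axes_times w' (exponents q m a b).1 (exponents q m a b).2 K.
Proof.
move=> Uw E; rewrite /axes_times !rmorphM !rmorphXn /= E; have Upw := cunit_pull q Uw.
case: q E Upw => [c|] /= E Upw.
  rewrite pull_some_varx pull_some_vary; have [->|c0] := eqVneq c 0.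
    exists (pull (Some 0) w); first exact: cunit_pull.
    rewrite /cst !rmorph0 addr0 exprMn !exprD; ring.
  (* For c <> 0 the old axis y = 0 misses the new point: y becomes x times the unit y' + c, absorbed
     into the unit factor. *)
  exists (pull (Some c) w * (vary + cst c) ^+ b).
    apply: cunitM => //; apply: cunitX; split.
      by apply: convergentD; [exact: convergent_vary|exact: convergent_cst].
    by rewrite unit00 !psD vary_coef /= add0r.
  by rewrite exprMn !exprD expr0; ring.
exists (pull None w) => //; rewrite pull_none_varx pull_none_vary exprMn !exprD; ring.
Qed.

(** This chart restricts to the identity on y = 0, so K divisible by y would make g divisible by
    y. *)
Lemma strict_other_axis_some m g K : pull (Some 0) g = varx ^+ m * K ->
  swap g 0%N <> 0 -> swap K 0%N <> 0.
Proof.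
move=> E sg0 sK0; apply: sg0; apply/funext=> k; rewrite ps0.
have := congr1 (fun h : S => h k 0%N) E; rewrite pull_some translate0 horner_coef0 coef_homog subn0.
rewrite varxE /swap /= => ->; case: ifP => // _; exact: (congr1 (@^~ (k - m)%N) sK0).
Qed.

Lemma strict_other_axis_none m g K : pull None g = vary ^+ m * K ->
  g 0%N <> 0 -> K 0%N <> 0.
Proof.
move=> E g0; rewrite -[K]swapK; apply: (@strict_other_axis_some m (swap g)) => //.
by rewrite -[LHS]swapK -pull_none E rmorphM rmorphXn /= swap_vary.
Qed.

(* F is the local equation of the total transform of a branch, with strict transform g. *)
Definition branch_total ax F : Prop := exists w a b g,
  [/\ cunit w, branch_equation g, compatible ax a b & F = axes_times w a b g] /\
  ((0 < a)%N -> g 0%N <> 0) /\ ((0 < b)%N -> swap g 0%N <> 0).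

Lemma branch_total_step i ax q F : branch_total ax F -> ~ normal_crossing (pull q F) ->
  branch_total (axes_step i ax q) (pull q F).
Proof.
move=> [w [a [b [g [[Uw bg cab ->] [ga gb]]]]]] nnc; have /branchP[cg g00 _] := bg.
have [m mg] := multiplicityP (branch_neq0 bg); have m0 := multiplicity_gt0 mg g00.
have [K [cK EK offK _]] := strict_transform q cg mg.
have [w' Uw' E] := pull_total a b Uw EK; rewrite E in nnc *.
have K00 : K 0%N 0%N = 0.
  apply/eqP/contraT => K00; case: nnc; apply: normal_crossing_axes => //.
  by split=> //; rewrite unit00.
exists w', (exponents q m a b).1, (exponents q m a b).2, K; split.
  split=> //; last exact: compatible_step.
  by have [] := branch_strict bg EK cK offK K00.
case: q offK EK {E nnc} => [c|] /= offK EK; split=> //.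
  by case: eqP => // c0 /gb; rewrite c0 in EK; exact: strict_other_axis_some EK.
by move=> /ga; exact: strict_other_axis_none EK.
Qed.

Lemma tangent_direction m g : multiplicity m g -> (0 < m)%N -> exists q, tangent q m g = 0.
Proof.
move=> [gm _] m0; have [e|ne] := eqVneq (g 0%N m) 0; first by exists None.
have sm : size (homog g m) = m.+1.
  apply/eqP; rewrite eqn_leq size_homog /= ltnNge; apply/negP=> sm.
  by have /eqP := nth_default 0 sm; rewrite coef_homog leqnn subnn (negPf ne).
have /closed_rootP[c /rootP rc] : size (homog g m) != 1%N by rewrite sm; case: (m) m0.
by exists (Some c).
Qed.

Lemma normal_crossing_y w b g : cunit w -> convergent g -> g 0%N 0%N = 0 -> g 1%N 0%N <> 0 ->
  normal_crossing (w * (vary ^+ b * g)).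
Proof.
move=> Uw cg g0 g1; rewrite -[X in normal_crossing X]swapK; apply: normal_crossing_swap.
rewrite !rmorphM rmorphXn /= swap_vary; apply: normal_crossing_x => //.
  exact: cunit_swap.
exact: convergent_swap.
Qed.

(** Look at a tangent direction q of the strict transform g. If q is the direction of the only
    exceptional axis, two exceptional curves and a branch meet at q, which is no normal crossing.
    Otherwise normal crossing at q makes the new strict transform transversal to the new curve; then
    g is smooth with tangent q, transversal to that axis, and F was already normal crossing. *)
Lemma free_last_point ax F : branch_total ax F -> isSome ax.1 != isSome ax.2 ->
  (forall q, normal_crossing (pull q F)) -> normal_crossing F.
Proof.
move=> [w [a [b [g [[Uw bg [ea eb] ->] [ga gb]]]]]]; rewrite -ea -eb => ab nc.
have /branchP[cg g00 _] := bg.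
have [m mg] := multiplicityP (branch_neq0 bg); have m0 := multiplicity_gt0 mg g00.
have [q tq] := tangent_direction mg m0.
have [K [cK EK offK K00]] := strict_transform q cg mg; rewrite tq in K00.
have [w' Uw' E] := pull_total a b Uw EK.
have [bK smo] := branch_strict bg EK cK offK K00.
have := nc q; rewrite E /axes_times {nc E}.
have [a0|a0] := posnP a; have [b0|b0] := posnP b; rewrite ?a0 ?b0 // in ab *.
- have g1 := gb b0; rewrite expr0 mul1r.
  case: q tq EK offK smo => [c|] /= tq EK offK smo.
    case: eqP => [c0|/eqP c0].
      move=> /normal_crossing_xy_inv H; case: H => //; first by rewrite add0n addn_gt0 b0.
      by rewrite c0 in EK; exact: strict_other_axis_some EK g1.
    rewrite expr0 mul1r => /normal_crossing_x_branch H.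
    have bm0 : (0 < 0 + b + m)%N by rewrite addn_gt0 b0.
    have [g01 g10] := smo (H Uw' bm0 bK offK).
    apply: normal_crossing_y => //; rewrite g10 mulNr => /eqP.
    by rewrite oppr_eq0 mulf_eq0 (negPf c0) => /eqP.
  rewrite expr0 mul1r add0n => /normal_crossing_swap; rewrite !rmorphM rmorphXn /= swap_vary.
  move=> /normal_crossing_x_branch H.
  have bm0 : (0 < b + m)%N by rewrite addn_gt0 b0.
  have [g10 _] := smo (H (cunit_swap Uw') bm0 (branch_swap bK) offK).
  exact: normal_crossing_y.
have g1 := ga a0; rewrite expr0 mul1r.
case: q tq EK offK smo => [c|] /= tq EK offK smo.
  rewrite if_same expr0 mul1r => /normal_crossing_x_branch H.
  have am0 : (0 < a + 0 + m)%N by rewrite !addn_gt0 a0.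
  have [g01 _] := smo (H Uw' am0 bK offK).
  exact: normal_crossing_x.
move=> /normal_crossing_xy_inv H; case: H => //; first by rewrite !addn_gt0 a0.
exact: strict_other_axis_none EK g1.
Qed.

Lemma axes_from_rcons i ax d q :
  axes_from i ax (rcons d q) = axes_step (i + size d) (axes_from i ax d) q.
Proof. by elim: d i ax => [|q' d IH] i ax /=; rewrite ?addn0 // IH addSnnS. Qed.

Lemma total_transform_rcons f d q : total_transform f (rcons d q) = pull q (total_transform f d).
Proof. by rewrite /total_transform foldl_rcons. Qed.

Lemma resolution_not_normal_crossing f d k : resolution_points f d -> (k <= size d)%N ->
  ~ normal_crossing (total_transform f (take k d)).
Proof.
move=> [nc res _]; case: k => [|k] kd; first by rewrite take0.
by rewrite (take_nth None kd); apply: (res k _ kd).2.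
Qed.

Lemma last_point_satellite f d : branch_equation f -> resolution_points f d -> d <> [::] ->
  isSome (axes_from 0 (None, None) d).1 && isSome (axes_from 0 (None, None) d).2.
Proof.
move=> bf rd d0.
have inv k : (k <= size d)%N ->
    branch_total (axes_from 0 (None, None) (take k d)) (total_transform f (take k d)).
  elim: k => [_|k IH kd].
    rewrite take0; exists 1, 0%N, 0%N, f; split=> //.
    by split=> //; [exact: cunit1|rewrite /axes_times !expr0 !mul1r].
  have := resolution_not_normal_crossing rd kd.
  rewrite (take_nth None kd) axes_from_rcons total_transform_rcons.
  by apply: branch_total_step; apply: IH; exact: ltnW.
have := inv _ (leqnn _); rewrite take_size => bt.
have := resolution_not_normal_crossing rd (leqnn _); rewrite take_size => nnc.
have [_ _ nc] := rd.
(* The point last reached always lies on the exceptional curve just created. *)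
have : isSome (axes_from 0 (None, None) d).1 || isSome (axes_from 0 (None, None) d).2.
  case/lastP: d d0 {rd inv bt nnc nc} => // d q _; rewrite axes_from_rcons.
  by case: q => [c|] //=; rewrite orbT.
have [eq|ne] := eqVneq (isSome (axes_from 0 (None, None) d).1) (isSome (axes_from 0 (None, None) d).2).
  by rewrite eq orbb andbb.
case: nnc; apply: (free_last_point bt ne) => q; rewrite -total_transform_rcons; exact: nc.
Qed.

Lemma normal_crossing_total f d : normal_crossing f -> normal_crossing (total_transform f d).
Proof.
elim/last_ind: d => // d q IH nc; rewrite total_transform_rcons.
by apply: normal_crossing_pull; exact: IH.
Qed.

Lemma branch_diagonal : branch_equation (vary - varx).
Proof.
apply/branchP; split=> [||A B cA cB E].
- by apply: convergentB; [exact: convergent_vary|exact: convergent_varx].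
- by rewrite !psB vary_coef varx_coef subrr.
rewrite !unit00; apply/orP/contraT; rewrite negb_or !negbK => /andP[/eqP A0 /eqP B0].
have := congr1 (fun h : S => h 0%N 1%N) E; rewrite psM2 !big_ord_recl !big_ord0 /=.
rewrite !psB vary_coef varx_coef A0 B0 mul0r mulr0 !addr0 subr0 => /eqP.
by rewrite oner_eq0.
Qed.

(** The branch for the tail of d is pushed forward along the head. Quantifying over w, a and b
    allows the tail to start in the presence of exceptional curves created before. At any other
    direction the strict transform is absent, which leaves a product of axes. *)
Lemma realization d : exists f, [/\ branch_equation f, f 0%N <> 0, swap f 0%N <> 0 &
  forall i ax w a b, cunit w -> compatible ax a b ->
   (forall k q, (k < size d)%N -> q <> nth None d k ->
     normal_crossing (total_transform (axes_times w a b f) (rcons (take k d) q))) /\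
   exists w' a' b', [/\ cunit w', compatible (axes_from i ax d) a' b' &
     total_transform (axes_times w a b f) d = axes_times w' a' b' (vary - varx)]].
Proof.
elim: d => [|q d [g [bg g0 sg0 IH]]].
  exists (vary - varx); split; [exact: branch_diagonal| | |].
  - move=> e; have /eqP := congr1 (@^~ 1%N) e.
    by rewrite psB psB vary_coef varx_coef /= subr0 oner_eq0.
  - move=> e; have /eqP := congr1 (@^~ 1%N) e.
    by rewrite /swap psB psB vary_coef varx_coef /= sub0r oppr_eq0 oner_eq0.
  by move=> i ax w a b Uw cab; split=> //; exists w, a, b.
have [f [m [U [[bf mf UU E] [f0 sf0 tf]]]]] := blow_down q bg g0 sg0.
have /branchP[cf f00 _] := bf; have m0 := multiplicity_gt0 mf f00.
exists f; split=> // i ax w a b Uw cab.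
have [w' Uw' Ew'] := pull_total a b Uw E.
have Et : pull q (axes_times w a b f) =
    axes_times (w' * U) (exponents q m a b).1 (exponents q m a b).2 g.
  by rewrite Ew' /axes_times; ring.
have [IH1 IH2] := IH i.+1 _ _ _ _ (cunitM Uw' UU) (compatible_step i q m0 cab).
split; last by rewrite -Et in IH2; exact: IH2.
case=> [|k] q' /= kd qq'; last by rewrite -/(pull q _) Et; exact: IH1.
have [K [cK EK _ K00]] := strict_transform q' cf mf.
have [w2 Uw2 Ew2] := pull_total a b Uw EK.
rewrite -/(pull q' _) Ew2; apply: normal_crossing_axes => //.
by split=> //; rewrite unit00 K00; apply/eqP; exact: tf.
Qed.

(** The strict transform of y = x meets the new curve only at the direction 1, away from both old
    axes, and transversally. *)
Lemma normal_crossing_last q w a b : cunit w ->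
  normal_crossing (pull q (axes_times w a b (vary - varx))).
Proof.
move=> Uw; have ax K : pull q (vary - varx) = axis q ^+ 1 * K -> cunit K ->
    normal_crossing (pull q (axes_times w a b (vary - varx))).
  move=> E UK; have [w' Uw' ->] := pull_total a b Uw E.
  exact: normal_crossing_axes.
case: q ax => [c|] ax; last first.
  apply: (ax (1 - varx)).
    by rewrite rmorphB /= pull_none_varx pull_none_vary expr1; ring.
  split; last by rewrite unit00 !psB !ps1 varx_coef /= subr0 oner_eq0.
  by apply: convergentB; [exact: convergent1|exact: convergent_varx].
have E : pull (Some c) (vary - varx) = varx ^+ 1 * (vary + cst (c - 1)).
  by rewrite rmorphB /= pull_some_varx pull_some_vary expr1 /cst !rmorphB !rmorph1; ring.
have [c1|c1] := eqVneq c 1.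
  have [w' Uw' ->] := pull_total a b Uw E.
  rewrite c1 subrr /cst !rmorph0 addr0 /= oner_eq0 /axes_times.
  have := normal_crossing_axes (a + b + 1) 1 Uw' (cunit1 R).
  by rewrite expr0 mul1r mulr1 expr1.
apply: (ax _ E); split.
  by apply: convergentD; [exact: convergent_vary|exact: convergent_cst].
by rewrite unit00 !psD vary_coef /= add0r subr_eq0.
Qed.

Lemma resolution_exists d :
  isSome (axes_from 0 (None, None) d).1 && isSome (axes_from 0 (None, None) d).2 ->
  exists2 f : S, branch_equation f & resolution_points f d.
Proof.
move=> /andP[ax1 ax2]; have [f [bf _ _ H]] := realization d.
have [|H1 [w [a [b [Uw [ea eb] E]]]]] := H 0%N (None, None) 1 0%N 0%N (cunit1 R).
  by split.
have Ef : axes_times 1 0 0 f = f by rewrite /axes_times !expr0 !mul1r.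
rewrite Ef in H1 E.
have nnc : ~ normal_crossing (total_transform f d).
  rewrite E => /normal_crossing_xy_inv; apply=> //; rewrite ?ea ?eb ?ax1 ?ax2 //.
  - move=> e; have /eqP := congr1 (@^~ 1%N) e.
    by rewrite psB psB vary_coef varx_coef /= subr0 oner_eq0.
  - move=> e; have /eqP := congr1 (@^~ 1%N) e.
    by rewrite /swap psB psB vary_coef varx_coef /= sub0r oppr_eq0 oner_eq0.
  - by rewrite !psB vary_coef varx_coef subrr.
(* Normal crossing persists under further blow-ups, so its failure at the last point implies its
   failure at every earlier one. *)
have nncE d1 d2 : d = d1 ++ d2 -> ~ normal_crossing (total_transform f d1).
  move=> Ed nc; apply: nnc; rewrite Ed /total_transform foldl_cat.
  exact: normal_crossing_total.
exists f => //; split.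
- exact: (nncE [::] d).
- move=> i q id; split=> [nnq|->].
    by apply: contrapT => nq; apply: nnq; exact: H1.
  by apply: (nncE _ (drop i.+1 d)); rewrite -take_nth // cat_take_drop.
- by move=> q; rewrite total_transform_rcons E; exact: normal_crossing_last.
Qed.
End Resolution.

(** * Enriques diagrams *)

Section Proximity.
Variable R : realType.
Implicit Types (d : seq (direction R)) (ax : axes).

Lemma axes_from_bounded d ax : ax = axes_from 0 (None, None) d ->
  [/\ forall j, ax.1 = Some j -> (j < size d)%N, forall j, ax.2 = Some j -> (j < size d)%N &
      ax.1 = ax.2 -> ax.1 = None].
Proof.
move->; elim/last_ind: d => [|d q [b1 b2 ne]]; first by split.
rewrite axes_from_rcons add0n size_rcons; case: q => [c|] /=; split=> //=.
- by move=> j [<-].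
- by case: ifP => // _ j /b2/ltnW.
- by case: ifP => // _ /esym/b2; rewrite ltnn.
- by move=> j /b1/ltnW.
- by move=> j [<-].
- by move/b1; rewrite ltnn.
Qed.

Lemma count_Some (o : option nat) k : (forall j, o = Some j -> (j < k)%N) ->
  count (fun j => o == Some j) (iota 0 k) = isSome o.
Proof.
case: o => [i|] b; last by apply/eqP; rewrite -leqn0 leqNgt -has_count; apply/hasPn.
rewrite -[RHS]/(true : nat); have <- : i \in iota 0 k by rewrite mem_iota b.
rewrite -(count_uniq_mem i (iota_uniq 0 k)); apply: eq_count => j /=.
by apply/eqP/eqP => [[]|->].
Qed.

(** The two axes never belong to the same exceptional curve, so counting the points to which P_k is
    proximate amounts to counting exceptional axes. *)
Lemma free_pointE d k : (k <= size d)%N ->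
  free_point d k = (isSome (axes_from 0 (None, None) (take k d)).1 +
                    isSome (axes_from 0 (None, None) (take k d)).2 == 1)%N.
Proof.
move=> kd; have [b1 b2 ne] := axes_from_bounded (erefl (axes_from 0 (None, None) (take k d))).
rewrite size_takel // in b1 b2.
rewrite /free_point /proximate; set ax := axes_from _ _ _ in b1 b2 ne *.
have := count_predUI (fun j => ax.1 == Some j) (fun j => ax.2 == Some j) (iota 0 k).
rewrite !count_Some // => <-; rewrite [X in (_ + X)%N](_ : _ = 0%N) ?addn0 //.
apply/eqP; rewrite -leqn0 leqNgt -has_count; apply/hasPn => j _ /=.
apply/negP=> /andP[/eqP e1 /eqP e2]; have := ne; rewrite e1 e2 => /(_ erefl).
by [].
Qed.
End Proximity.

(** * Local characterization of the diagrams of branches *)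

Section ValidDiagrams.
Variable n : nat.
Hypothesis hn : (3 <= n)%N.
Implicit Types D : diagram n.

(** The conventions at the ends matter: [straight D 0] reads e_1 and [straight D n] is the default
    [false], so the last condition also makes v_0, v_1 and v_(n-1) neutral. *)
Definition valid D := [&& ~~ straight D 1, straight D n.-1 &
  [forall v : 'I_n, breaking D v ==> straight D v && straight D v.+1]].

Lemma valid_breaking D v : valid D -> breaking D v -> straight D v && straight D v.+1.
Proof.
case/and3P=> _ _ /forallP H bv; have vn : (v < n)%N.
  by rewrite ltnNge; apply/negP=> nv; move: bv; rewrite /breaking nth_default ?size_tuple.
by have := H (Ordinal vn); rewrite /= bv.
Qed.

Lemma straight0 D : straight D 0 = straight D 1. Proof. by []. Qed.

Variable R : realType.

Lemma branch_diagram_valid D : branch_diagram R D -> valid D.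
Proof.
move=> [f [d [bf rd sd [c1 c2 c3]]]].
have dn : size d = n.-1 by rewrite -sd.
have d0 : d <> [::] by move=> e; move: hn; rewrite -sd e.
apply/and3P; split.
- rewrite c1; last by apply/andP; split; lia.
  rewrite free_pointE; last by rewrite dn; lia.
  by case: d d0 {bf rd sd c1 c2 c3 dn} => // q d _; rewrite /= take0; case: q => [c|] //=; case: ifP.
- apply/negPn; rewrite c1; last by apply/andP; split; lia.
  rewrite -dn free_pointE // take_size.
  by have /andP[-> ->] := last_point_satellite bf rd d0.
apply/forallP=> v; apply/implyP => /(c3 v (ltn_ord v)).1 [i [k [vi ri ik si]]].
rewrite vi si /=; have [[_ sp _] _ _] := c2 i k ri ik; apply: sp.
by rewrite ltnSn.
Qed.

Section Directions.
Variable D : diagram n.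
Hypothesis vD : valid D.
Local Notation s := (straight D).
Local Notation br := (breaking D).

Let s1 : s 1 = false. Proof. by case/and3P: vD => /negPf. Qed.

(* the next satellite point lies on the exceptional curve E(P_(k-1)) *)
Definition turns k := br k || ~~ s k.

(* E(P_k) is y = 0 in the coordinates chosen at P_(k+1) *)
Fixpoint vertical k : bool :=
  if k is k'.+1 then s k.+1 && (turns k (+) vertical k') else false.

(** Direction from P_k to P_(k+1). A satellite point lies on one of the two axes; for a free point
    any nonzero slope would do, and 1 is taken. *)
Definition dir k : direction R :=
  if vertical k then None else if s k.+1 then Some 0 else Some 1.

(* the index i < k - 1, if any, such that P_k is proximate to P_i *)
Fixpoint older k : option nat :=
  if k is k'.+1 then if s k then (if turns k' then Some k'.-1 else older k') else None
  else None.

Definition dirs := mkseq dir n.-1.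

Lemma size_dirs : (size dirs).+1 = n. Proof. by rewrite size_mkseq; lia. Qed.

(** A turn at k + 1 keeps the newer curve E(P_k) through P_(k+2), otherwise the older curve is kept;
    the exclusive or in [vertical] tells which axis that is. *)
Lemma axes_dirs k : (k < n.-1)%N -> axes_from 0 (None, None) (take k.+1 dirs) =
  if vertical k then (older k.+1, Some k) else (Some k, older k.+1).
Proof.
elim: k => [|k IH] kn.
  rewrite (take_nth None) ?size_mkseq // take0 nth_mkseq //.
  by rewrite /dir /= s1 /= if_same.
rewrite (take_nth None) ?size_mkseq // axes_from_rcons size_takel ?size_mkseq; last exact: ltnW.
rewrite IH ?(ltnW kn) // nth_mkseq // add0n /dir.
rewrite [vertical k.+1]/= [older k.+2]/=.
case: (s k.+2) => /=; last by rewrite oner_eq0.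
by case: (turns k.+1); case: (vertical k); rewrite /= ?eqxx.
Qed.

Lemma proximate_dirs k j : (k.+1 < n)%N ->
  proximate dirs k.+1 j = (j == k) || (older k.+1 == Some j).
Proof.
move=> kn; rewrite /proximate axes_dirs; last by lia.
have E : (Some k == Some j) = (j == k) by rewrite eq_sym; apply/eqP/eqP => [[]|->].
by case: (vertical k) => /=; rewrite E // orbC.
Qed.

Lemma proximate_dirs0 j : proximate dirs 0 j = false.
Proof. by rewrite /proximate take0. Qed.

(** In terms of the diagram: [v_(i+1) v_k] is a straight path with at least one edge which cannot be
    extended to the left. *)
Lemma olderP k i : reflect
  [/\ (i.+1 < k)%N, forall j, (i.+1 < j <= k)%N -> s j,
      forall j, (i.+1 < j < k)%N -> ~~ br j & turns i.+1] (older k == Some i).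
Proof.
apply: (iffP eqP).
  elim: k => // k IH /=; case: ifP => // sk; case: ifP => tk.
    case: k {IH} sk tk => [|k]; first by rewrite s1.
    move=> sk tk [<-]; split=> // j; last by lia.
    by move=> jk; have -> : j = k.+2 by lia.
  move=> /IH[ik H1 H2 ti]; split=> //; first exact: ltnW.
    move=> j /andP[ij]; rewrite leq_eqVlt => /orP[/eqP -> //|jk].
    by apply: H1; rewrite ij -ltnS.
  move=> j /andP[ij]; rewrite ltnS leq_eqVlt => /orP[/eqP ->|jk].
    by move/negbT: tk; rewrite negb_or => /andP[].
  by apply: H2; rewrite ij.
elim: k => [|k IH] [ik H1 H2 ti] //=; rewrite H1 ?leqnn ?ik //.
have [e|ne] := eqVneq i.+1 k; first by rewrite -e ti.
have ik' : (i.+1 < k)%N by rewrite ltn_neqAle ne -ltnS.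
rewrite /turns H1 ?ik' ?leqnSn // (negPf (H2 k _)) ?ik' //=.
apply: IH; split=> // j /andP[ij jk]; first by apply: H1; rewrite ij ltnW.
by apply: H2; rewrite ij ltnW.
Qed.

Lemma older_straight k : isSome (older k.+1) = s k.+1.
Proof.
elim: k => [|k IH]; first by rewrite /= s1.
rewrite /=; case: (s k.+2) => //; case: ifP => // tk.
move/negbT: tk; rewrite negb_or negbK => /andP[_ sk].
by move: IH; rewrite /= sk => ->.
Qed.

Lemma proximity_older i k : proximity_range n dirs i k -> (i.+2 <= k)%N -> older k = Some i.
Proof.
move=> [_ [kn H]] ik; have := H k kn; rewrite leqnn (ltnW ik).
case: k kn ik {H} => // k kn ik; rewrite proximate_dirs // => /orP[/eqP e|/eqP //].
by rewrite e ltnn in ik.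
Qed.

Lemma dirs_enriques : is_enriques_diagram dirs D.
Proof.
split=> [[|i] // i_n|i k ri ik|v vn].
- rewrite free_pointE; last by rewrite size_mkseq; lia.
  rewrite axes_dirs; last by lia.
  rewrite -older_straight; case: (vertical i) => /=; last by case: isSome.
  by case: isSome.
- have := proximity_older ri ik => /eqP /olderP[ik' H1 H2 ti].
  have [i_n [kn H]] := ri.
  split; first by split=> //; rewrite (ltnW ik').
  - rewrite /= => _ [_ sp1 sp2]; move: ti; rewrite /turns sp1 ?ltnSn //= ?(ltnW ik) //.
    by rewrite orbF (negPf (sp2 _ _)) // ltnSn.
  (* An extension to the right would make P_(k+1) proximate to P_i. *)
  move=> kn' [_ sp1 sp2]; have := H k.+1 kn'; rewrite ltnn andbF.
  rewrite proximate_dirs // => /negbT; rewrite negb_or => /andP[_ /negP]; apply.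
  by apply/olderP; split=> //; exact: ltnW.
split=> [bv|[i [k [-> ri ik si]]]]; last first.
  (* The path starts with a turn at v_(i+1), and e_(i+1) is straight, so the turn comes from a
     breaking vertex. *)
  have := proximity_older ri ik => /eqP /olderP[_ _ _].
  by rewrite /turns si orbF.
have /andP[sv sv1] := valid_breaking vD bv.
case: v vn bv sv sv1 => [|i] vn bv sv sv1; first by rewrite straight0 s1 in sv.
have vn1 : (i.+2 < n)%N.
  rewrite ltnNge; apply/negP=> nv; move: sv1; rewrite /straight nth_default //.
  by rewrite size_tuple /=; lia.
have oi : older i.+2 = Some i by rewrite /= sv1 /turns bv.
(* The points proximate to P_i form an interval, which ends at the largest k with [older k] equal to
   i. *)
have exk : exists k, (k < n)%N && (older k == Some i) by exists i.+2; rewrite vn1 oi eqxx.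
have bnd k : (k < n)%N && (older k == Some i) -> (k <= n)%N by move=> /andP[/ltnW].
have [k /andP[kn /olderP[ik H1 H2 ti]] max] := ex_maxnP exk bnd.
exists i, k; split=> //; split; first exact: ltnW.
split=> // -[|j] jn; first by rewrite proximate_dirs0.
rewrite proximate_dirs // ltnS; apply/orP/andP => [[/eqP <-|oj]|[ij jk]].
- by split=> //; apply: ltnW; apply: max; rewrite vn1 oi eqxx.
- by have /olderP[ij _ _ _] := oj; split; [by move: ij; rewrite ltnS; exact: ltnW|by apply: max; rewrite jn oj].
have [->|ne] := eqVneq i j; first by left.
right.
have ij' : (i.+1 < j.+1)%N by rewrite ltnS ltn_neqAle ne.
apply/olderP; split=> // l /andP[il lj]; first by apply: H1; rewrite il (leq_trans lj).
by apply: H2; rewrite il (leq_trans lj).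
Qed.
End Directions.

Lemma valid_branch_diagram D : valid D -> branch_diagram R D.
Proof.
move=> vD; have [|f bf rf] := @resolution_exists R (dirs D).
  have Ed : take n.-2.+1 (dirs D) = dirs D by rewrite take_oversize // size_mkseq; lia.
  rewrite -Ed axes_dirs //; last by lia.
  have so : isSome (older D n.-2.+1).
    rewrite older_straight //; have -> : n.-2.+1 = n.-1 by lia.
    by case/and3P: vD.
  by case: ifP => _; rewrite so.
by exists f, (dirs D); split=> //; [exact: size_dirs|exact: dirs_enriques].
Qed.
End ValidDiagrams.

(** * Rigidity of valid diagrams *)

Section Isomorphisms.
Variable m : nat.
Local Notation n := m.+3.
Implicit Types D : diagram n.

Lemma diagram_iso_refl D : diagram_iso D D.
Proof.
apply/existsP; exists 1%g; apply/existsP; exists 1%g; apply/and3P; split.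
- apply/forallP=> e; rewrite perm1; apply/eqP; rewrite (eq_imset _ (@perm1 _)).
  exact: imset_id.
- by apply/forallP=> e; rewrite perm1.
- by apply/forallP=> v; rewrite perm1.
Qed.

Lemma diagram_iso_eq D D' : valid D -> valid D' -> diagram_iso D D' -> D = D'.
Proof.
move=> vD vD' /existsP[s /existsP[t /and3P[/forallP st /forallP tD /forallP sD]]].
have ends (e : 'I_n.-1) (a b : 'I_n) : a = e :> nat -> b = e.+1 :> nat ->
    (s a = t e :> nat /\ s b = (t e).+1 :> nat) \/ (s a = (t e).+1 :> nat /\ s b = t e :> nat).
  move=> ea eb; have ab : (s a : nat) <> s b.
    by move=> /val_inj/perm_inj E; move: eb; rewrite -E ea => /eqP; rewrite ltn_eqF.
  have mem (v : 'I_n) : (v == e :> nat) || (v == e.+1 :> nat) ->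
      ((s v : nat) == t e) || ((s v : nat) == (t e).+1).
    move=> ve; have : s v \in edge_ends (t e) by rewrite -(eqP (st e)) imset_f // inE.
    by rewrite inE.
  have := mem a; have := mem b; rewrite ea eb !eqxx /= orbT.
  by move=> /(_ isT)/orP[]/eqP Eb /(_ isT)/orP[]/eqP Ea; move: ab; rewrite Ea Eb; auto.
have lift_e (e : 'I_n.-1) : exists a b : 'I_n, a = e :> nat /\ b = e.+1 :> nat.
  have e1 : (e.+1 < n)%N by rewrite ltnS.
  by exists (Ordinal (ltnW e1)), (Ordinal e1).
(* Since v_0 lies on a single edge, its image lies on a single edge and is an end of the path. *)
have edge_at0 (e : 'I_n.-1) : (s ord0 = t e :> nat) \/ (s ord0 = (t e).+1 :> nat) -> e = ord0.
  have [a [b [ea eb]]] := lift_e e.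
  have key (v : 'I_n) : s ord0 = s v :> nat -> v = ord0 by move=> /val_inj/perm_inj.
  have atb : b <> ord0 by move=> b0; move: eb; rewrite b0.
  have ata : a = ord0 -> e = ord0 by move=> a0; apply: val_inj; rewrite /= -ea a0.
  have [[Ea Eb]|[Ea Eb]] := ends e a b ea eb; case=> H.
  - by apply: ata; apply: key; rewrite H Ea.
  - by case: atb; apply: key; rewrite H Eb.
  - by case: atb; apply: key; rewrite H Eb.
  - by apply: ata; apply: key; rewrite H Ea.
have s0 : s ord0 = 0%N :> nat.
  have := ltn_ord (s ord0); case E : (nat_of_ord (s ord0)) => [|p] // pn.
  have pn1 : (p < n.-1)%N by [].
  have t0 : t ord0 = Ordinal pn1.
    rewrite -(edge_at0 ((t^-1)%g (Ordinal pn1))) permKV //; right; exact: E.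
  (* If the image of v_0 has an edge to its right, it lies on two edges, which is excluded;
     otherwise it is v_(n-1), and the curved edge e_1 would go to the straight edge e_(n-1). *)
  have [pl|pm] := ltnP p.+1 n.-1.
    have : (t^-1)%g (Ordinal pl) = ord0 by apply: edge_at0; left; rewrite permKV; exact: E.
    move=> /(congr1 t); rewrite permKV t0 => /(congr1 (@nat_of_ord _)) /= /eqP.
    by rewrite eqn_leq ltnn.
  have := tD ord0; rewrite t0 !(tnth_nth false) /=.
  have -> : p = m.+1 by lia.
  by case/and3P: vD vD' => /negPf d1 _ _ /and3P[_ d2 _]; rewrite /straight /= in d1 d2; rewrite d1 d2.
(* The image of the next vertex is a neighbour of v_k other than v_(k-1), which is already taken. *)
have main k : forall v : 'I_n, v = k :> nat -> s v = v.
  elim/ltn_ind: k => -[|k] IH v vk.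
    by apply: val_inj; rewrite /= vk -s0; congr (val (s _)); apply: val_inj.
  have kn1 : (k < n.-1)%N by have := ltn_ord v; rewrite vk.
  have kn : (k < n)%N by apply: ltnW.
  have sa : s (Ordinal kn) = k :> nat by rewrite (IH k (ltnSn k)).
  have [[Ea Eb]|[Ea Eb]] := ends (Ordinal kn1) (Ordinal kn) v erefl vk.
    by apply: val_inj; rewrite /= Eb -Ea sa vk.
  have k0 : (0 < k)%N by rewrite -sa Ea.
  have k'n : (k.-1 < n)%N by exact: leq_ltn_trans (leq_pred k) kn.
  have sk' : s (Ordinal k'n) = k.-1 :> nat by rewrite (IH k.-1) //; lia.
  have : Ordinal k'n = v by apply/(@perm_inj _ s)/val_inj; rewrite /= sk' Eb; lia.
  by move/(congr1 (@nat_of_ord _)); rewrite /= vk; lia.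
have sE v : s v = v by exact: main.
have tE e : t e = e.
  have [a [b [ea eb]]] := lift_e e; apply: val_inj => /=.
  have := ends e a b ea eb; rewrite !sE ea eb.
  by move: (nat_of_ord (t e)) (nat_of_ord e) => x y; lia.
case: D D' tD sD {vD vD' st} => [E V] [E' V'] /= tD sD; congr (_, _); apply: eq_from_tnth => i.
  by rewrite -[in RHS](tE i) (eqP (tD i)).
by rewrite -[in RHS](sE i) (eqP (sD i)).
Qed.
End Isomorphisms.

(** * Counting *)

Section Counting.

(* The pairs are (v_i is breaking, e_(i+1) is straight), and p tells whether e_i is straight *)
Fixpoint admissible (p : bool) (l : seq (bool * bool)) : bool :=
  if l is (b, e) :: l' then (b ==> p && e) && admissible e l' else p.

Fixpoint admissible_words (p : bool) (k : nat) : seq (seq (bool * bool)) :=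
  if k is k'.+1 then
    [seq (false, false) :: l | l <- admissible_words false k'] ++
    [seq (false, true) :: l | l <- admissible_words true k'] ++
    (if p then [seq (true, true) :: l | l <- admissible_words true k'] else [::])
  else if p then [:: [::]] else [::].

Lemma mem_map_cons (T : eqType) (x : T) (s : seq (seq T)) l :
  (l \in [seq x :: l' | l' <- s]) = if l is y :: l' then (y == x) && (l' \in s) else false.
Proof.
case: l => [|y l]; first by apply/mapP=> -[].
apply/mapP/andP => [[l' ls [-> ->]]|[/eqP-> ls]]; first by rewrite eqxx.
by exists l.
Qed.

Lemma mem_admissible_words p k l :
  (l \in admissible_words p k) = (size l == k) && admissible p l.
Proof.
elim: k p l => [|k IH] p l /=; first by case: p; case: l => [|[]].
have memif s : (l \in if p then s else [::]) = p && (l \in s) by case: (p).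
rewrite !mem_cat memif !mem_map_cons.
case: l {memif} => [|[b e] l]; first by rewrite andbF.
by rewrite !IH eqSS; case: b; case: e; case: p; rewrite /= ?andbF ?orbF.
Qed.

Lemma uniq_admissible_words p k : uniq (admissible_words p k).
Proof.
elim: k p => [|k IH] p /=; first by case: p.
have inj (x : bool * bool) : injective (cons x) by move=> l l' [].
have U x q : uniq [seq x :: l | l <- admissible_words q k] by rewrite map_inj_uniq.
have dis x y q q' : x != y -> ~~ has (mem [seq x :: l | l <- admissible_words q k])
     [seq y :: l | l <- admissible_words q' k].
  move=> xy; apply/hasPn => _ /mapP[l _ ->]; rewrite /= mem_map_cons.
  by rewrite eq_sym (negPf xy).
rewrite !cat_uniq U has_cat negb_or dis //= U /=.
by case: p; rewrite /= ?dis ?U.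
Qed.

Lemma fibSS n : fib n.+2 = (fib n.+1 + fib n)%N. Proof. by []. Qed.

(** The boolean p serves as the offset of the index: F_(2k) after a curved edge, F_(2k+1) after a
    straight one. *)
Lemma size_admissible_words p k : size (admissible_words p k) = fib (2 * k + p).
Proof.
elim: k p => [|k IH] p; first by case: p.
have sizeif (s : seq (seq (bool * bool))) : size (if p then s else [::]) = (p * size s)%N.
  by case: (p); rewrite ?mul1n.
rewrite [admissible_words _ _]/= !size_cat sizeif !size_map !IH mulnS -addnA !add2n.
rewrite -[nat_of_bool true]/1%N -[nat_of_bool false]/0%N addn0 addn1.
by case: p {sizeif}; rewrite ?mul1n ?mul0n ?addn1 ?addn0 !fibSS; lia.
Qed.

Lemma admissibleP (p : bool) (l : seq (bool * bool)) : reflect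
  (last p (unzip2 l) /\ forall i, nth false (unzip1 l) i ->
     nth false (p :: unzip2 l) i && nth false (p :: unzip2 l) i.+1)
  (admissible p l).
Proof.
elim: l p => [|[b e] l IH] p /=.
  by apply: (iffP idP) => [pp|[]//]; split=> // i; rewrite nth_nil.
apply: (iffP andP) => [[be /IH[ll H]]|[ll H]].
  by split=> // -[|i] /=; [apply/implyP|exact: H].
split; first by apply/implyP; exact: (H 0%N).
by apply/IH; split=> // i; exact: (H i.+1).
Qed.

Variable m : nat.
Local Notation n := m.+3.
Implicit Types D : diagram n.

(** Validity fixes e_1, v_0 and v_(n-1); the n - 2 pairs (v_i, e_(i+1)) with 1 <= i <= n - 2 remain
    and form the word l. *)
Lemma validP D : reflect
  (exists2 l, (size l == m.+1) && admissible false l &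
     (tval D.1, tval D.2) = (false :: unzip2 l, false :: rcons (unzip1 l) false))
  (valid D).
Proof.
have validE l : size l = m.+1 ->
    tval D.1 = false :: unzip2 l -> tval D.2 = false :: rcons (unzip1 l) false ->
    valid D = admissible false l.
  move=> sl E V; have brE v : breaking D v.+1 = nth false (unzip1 l) v.
    rewrite /breaking V /= nth_rcons; case: ifP => // /negbT; rewrite -leqNgt => h.
    by rewrite (nth_default _ h) if_same.
  have br0 : breaking D 0 = false by rewrite /breaking V.
  have stE v : straight D v.+1 = nth false (false :: unzip2 l) v by rewrite /straight E.
  have lastE : straight D n.-1 = last false (unzip2 l).
    by rewrite stE -[m.+1]sl -(size_map snd) -[RHS](nth_last false (false :: unzip2 l)).
  apply/and3P/admissibleP => [[_ sl' /forallP H]|[sl' H]].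
    split=> [|i bi]; first by rewrite -lastE.
    have im : (i.+1 < n)%N.
      rewrite ltnNge; apply/negP=> ni; move: bi; rewrite nth_default // size_map sl.
      exact: ltnW.
    by have := H (Ordinal im); rewrite /= brE bi !stE.
  split; [by rewrite stE|by rewrite lastE|apply/forallP=> -[[|v] vn]].
    by rewrite /= br0.
  by rewrite [nat_of_ord _]/= brE !stE; apply/implyP; exact: H.
apply: (iffP idP) => [vD|[l /andP[/eqP sl al] [E V]]]; last by rewrite (validE l).
have s10 : straight D 1 = false by case/and3P: vD => /negPf.
have b00 : breaking D 0 = false.
  by apply/negP=> /(valid_breaking vD); rewrite straight0 s10.
have bl : breaking D n.-1 = false.
  apply/negP=> /(valid_breaking vD) /andP[_].
  by rewrite /straight nth_default // size_tuple.
have sz1 : size (tval D.1) = m.+2 by exact: size_tuple.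
have sz2 : size (tval D.2) = m.+3 by exact: size_tuple.
have [e [E eE]] : exists e E, tval D.1 = e :: E.
  by case: (tval D.1) sz1 => // e E; exists e, E.
have [v [V [w eV]]] : exists v V w, tval D.2 = v :: rcons V w.
  by case: (tval D.2) sz2 => // v; case/lastP => // V w; exists v, V, w.
have sE : size E = m.+1.
  have : size (e :: E) = m.+2 by rewrite -eE; exact: size_tuple.
  by case.
have sV : size V = m.+1.
  have : size (v :: rcons V w) = m.+3 by rewrite -eV; exact: size_tuple.
  by rewrite /= size_rcons => -[].
move: s10 b00 bl; rewrite /straight /breaking eE eV /= => e0 v0.
rewrite nth_rcons sV ltnn eqxx => w0; subst e v w.
have s12 : size (zip V E) = m.+1 by rewrite size1_zip sV ?sE.
have z1 : unzip1 (zip V E) = V by rewrite unzip1_zip // sV sE.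
have z2 : unzip2 (zip V E) = E by rewrite unzip2_zip // sV sE.
exists (zip V E); last by rewrite z1 z2.
by rewrite s12 eqxx /= -validE // ?z1 ?z2.
Qed.

Lemma card_valid : #|[set D : diagram n | valid D]| = fib (2 * n - 4).
Proof.
pose phi D : seq bool * seq bool := (tval D.1, tval D.2).
pose chi (l : seq (bool * bool)) := (false :: unzip2 l, false :: rcons (unzip1 l) false).
have phi_inj : injective phi by move=> [E V] [E' V'] [/val_inj-> /val_inj->].
have chi_inj : injective chi.
  move=> l l' [E2 /rcons_inj[E1]].
  by rewrite -(zip_unzip l) -(zip_unzip l') E1 E2.
have -> : (2 * n - 4 = 2 * m.+1 + false)%N by rewrite addn0; lia.
rewrite -size_admissible_words -(size_map chi) cardE -(size_map phi).
apply/perm_size/uniq_perm.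
- by rewrite map_inj_uniq // enum_uniq.
- by rewrite map_inj_uniq // uniq_admissible_words.
move=> x; apply/mapP/mapP => [[D]|[l]].
  rewrite mem_enum inE => /validP[l Hl E] ->.
  by exists l => //; rewrite mem_admissible_words.
rewrite mem_admissible_words => Hl ->; have /andP[/eqP sl _] := Hl.
have sE : size (false :: unzip2 l) == n.-1 by rewrite /= size_map sl.
have sV : size (false :: rcons (unzip1 l) false) == n by rewrite /= size_rcons size_map sl.
exists ((Tuple sE, Tuple sV) : diagram n) => //.
by rewrite mem_enum inE; apply/validP; exists l.
Qed.
End Counting.

Unset Implicit Arguments.
Local Close Scope ring_scope.

Theorem theorem3p1 (R : realType) (n : nat) (hn : 3 <= n) :
  #|enriques_classes R n| = fib (2 * n - 4).
Proof.
case: n hn => [|[|[|m]]] // hn; rewrite -card_valid /enriques_classes.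
have -> : [set D | `[< branch_diagram R D >]] = [set D : diagram m.+3 | valid D].
  apply/setP=> D; rewrite !inE; apply/asboolP/idP.
    exact: branch_diagram_valid.
  exact: valid_branch_diagram.
(* The class of a valid diagram determines it: the class contains the diagram, and isomorphic valid
   diagrams are equal. *)
rewrite /equivalence_partition card_in_imset // => D D'; rewrite !inE => vD vD' E.
have : D \in [set y in [set D | valid D] | diagram_iso D y] by rewrite !inE vD diagram_iso_refl.
by rewrite E !inE vD => /diagram_iso_eq ->.
Qed.
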